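(* If $z>1$, then $E$ has a minimiser in $\mathcal{X}_1$; that is, if $e_0=\inf_{v\in\mathcal{X}_1}E[v]$, then there exists $u\in\mathcal{X}_1$ such that $E[u]=e_0$.
   Context: Let $z\in\mathbb{R}$ be the charge ratio. $H^1$ is the space of functions $u:\mathbb{R}\to\mathbb{R}$ with $\|u'\|_2^2+\|u\|_2^2<\infty$; $\mathcal{X}=\{u\in H^1:\int_{\mathbb{R}}|x|u(x)^2\,dx<\infty\}$; $\mathcal{X}_1=\{u\in\mathcal{X}:\|u\|_2=1\}$. The energy (for a point charge background $\rho=-z\delta_0$) is $$E[u]=\int_{\mathbb{R}}|u'(x)|^2\,dx-\frac12\int_{\mathbb{R}}\int_{\mathbb{R}}|x-y|\,u(x)^2u(y)^2\,dx\,dy+z\int_{\mathbb{R}}|x|\,u(x)^2\,dx .$$ *)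

(* Defs.v *)
From HB Require Import structures.
From mathcomp Require Import all_boot all_order all_algebra.
From mathcomp Require Import all_classical all_reals all_analysis.

Set Implicit Arguments.
Unset Strict Implicit.
Unset Printing Implicit Defensive.

Import Order.TTheory GRing.Theory Num.Theory.
Import numFieldNormedType.Exports.

Local Open Scope classical_set_scope.
Local Open Scope ring_scope.

Section Sobolev.
Context {R : realType}.
Local Notation mu := (@lebesgue_measure R).

Definition test_function (phi : R -> R) : Prop :=
  (forall (n : nat) (x : R), derivable (phi^`(n))%classic x 1) /\
  compact (closure [set x | phi x != 0]).

Definition weak_derivative (u g : R -> R) : Prop :=
  [/\ locally_integrable setT u, locally_integrable setT g &
      forall phi : R -> R, test_function phi ->
        \int[mu]_x (u x * (phi^`())%classic x) = - \int[mu]_x (g x * phi x)].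

(* Elements of the spaces below are functions rather than almost-everywhere
   classes: a class belongs to H1 iff one (equivalently, each) of its
   measurable representatives does, and all representatives have the same
   energy. *)
Definition H1 : set (R -> R) :=
  [set u | u \in Lfun mu 2%:E /\
           exists2 g, weak_derivative u g & g \in Lfun mu 2%:E].

(* A weak derivative is unique up to a null set, so the choice made here does
   not affect integrals. The default 0 is never reached on H1. *)
Definition wderiv (u : R -> R) : R -> R := xget (cst 0) (weak_derivative u).

Definition calX : set (R -> R) :=
  [set u | H1 u /\ (\int[mu]_x (`|x| * u x ^+ 2)%:E < +oo)%E].

Definition calX1 : set (R -> R) :=
  [set u | calX u /\ ('N[mu]_2%:E[EFin \o u] = 1)%E].

(* All the integrals converge absolutely when u lies in calX; outside calX the
   value is not meaningful. *)
Definition energy (z : R) (u : R -> R) : R :=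
  \int[mu]_x (`|wderiv u x| ^+ 2)
  - 2^-1 * \int[mu]_x (\int[mu]_y (`|x - y| * u x ^+ 2 * u y ^+ 2))
  + z * \int[mu]_x (`|x| * u x ^+ 2).

End Sobolev.

(* Main.v *)
Require Import Defs.
From mathcomp Require Import all_boot all_order all_algebra.
From mathcomp Require Import all_classical all_reals all_analysis.
From mathcomp Require Import measurable_realfun ring lra.

(** For u of mass 1 the two potential terms of the energy merge into a single
double integral of [K x y * u x ^+ 2 * u y ^+ 2], where
[K x y = z / 2 * (|x| + |y|) - 1 / 2 * |x - y|] ([interactionE]).  The triangle
inequality gives [K x y >= (z - 1) / 2 * (|x| + |y|)].  This is used twice.
First, K is nonnegative, so along a sequence that converges pointwise the
potential energy is lower semicontinuous by Fatou's lemma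
([interaction_fatou]), although it contains the repulsive term with a minus
sign.  Secondly, since z > 1, the energy bounds both the integral of the
squared derivative and the first moment of the density ([potential_ge]).

A minimising sequence therefore has bounded derivatives in L2 and bounded
first moments.  A bound on the derivative gives a Hölder-1/2 estimate, and an
Arzelà-Ascoli extraction yields a subsequence converging almost everywhere
([weak_compactness]).  The first moments prevent mass from escaping to
infinity, so the limit still has mass 1 ([limit_mass]).  Finally the kinetic
energy is lower semicontinuous ([kinetic_lsc]), and the limit is a minimiser.

Two steps differ from the usual argument.  The Hölder estimate is obtained without a
continuous representative: at a Lebesgue point, u is the limit of its averages
against smooth bumps ([bump_avg_cvg]), and a difference of two bumps is the
derivative of a smooth plateau, so that the weak derivative can be tested
against it ([weak_derivative_holder]).  The same averages show that a weak
derivative is unique up to a null set ([weak_derivative_unique]), which makes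
the arbitrary choice made by [wderiv] harmless.  Lower semicontinuity of the
kinetic energy does not go through weak compactness of balls of L2: elements of
almost minimal norm in a decreasing sequence of convex sets form a Cauchy
sequence by the parallelogram identity, and their limit is the derivative of
the limit function. *)

Set Implicit Arguments.
Unset Strict Implicit.
Unset Printing Implicit Defensive.

Import Order.TTheory GRing.Theory Num.Theory.
Import numFieldNormedType.Exports.

Local Open Scope classical_set_scope.
Local Open Scope ring_scope.

(** * Smooth bumps and smooth steps *)

Section Bump.
Context {R : realType}.
Implicit Types (f g : R -> R) (x a d y t : R) (p : {poly R}).

Definition smooth f := forall n x, derivable (f^`(n))%classic x 1.

(** Explicit formulas for iterated derivatives are avoided by exhibiting a class
of functions that is stable under differentiation. *)
Lemma smooth_closed (S : set (R -> R)) :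
  (forall f, S f -> exists2 g, S g & forall x, is_derive x 1 f (g x)) ->
  forall f, S f -> smooth f.
Proof.
move=> Sd f Sf.
have Sn n : S (f^`(n))%classic.
  elim: n => [//|n IH]; rewrite derive1nS.
  have [g Sg gd] := Sd _ IH.
  suff -> : ((f^`(n))^`())%classic = g by [].
  by apply/funext => x; rewrite derive1E; have := gd x; move/@derive_val.
by move=> n x; have [g _ gd] := Sd _ (Sn n); exact: ex_derive.
Qed.

Lemma smooth_is_derive f x : smooth f -> is_derive x 1 f (f^`()%classic x).
Proof.
move=> sf; rewrite derive1E; apply: DeriveDef => //; exact: (sf 0%N).
Qed.

Lemma smooth_derive f : smooth f -> smooth (f^`())%classic.
Proof. by move=> sf n x; have := sf n.+1 x; rewrite derive1Sn. Qed.

Lemma smooth_affine_comb f g (c d s t y z : R) : smooth f -> smooth g ->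
  smooth (fun x => c * f (s * (x - y)) + d * g (t * (x - z))).
Proof.
move=> sf sg.
apply: (@smooth_closed [set h | exists c d f g, [/\ smooth f, smooth g &
   h = (fun x => c * f (s * (x - y)) + d * g (t * (x - z)))]]); last first.
  by exists c, d, f, g.
move=> _ [c' [d' [f' [g' [sf' sg' ->]]]]].
exists (fun x => (c' * s) * (f'^`()%classic (s * (x - y))) +
                 (d' * t) * (g'^`()%classic (t * (x - z)))).
  exists (c' * s), (d' * t), (f'^`()%classic), (g'^`()%classic).
  by split; [exact: smooth_derive|exact: smooth_derive|reflexivity].
move=> x.
have H (h : R -> R) (s0 y0 : R) : smooth h ->
    is_derive x 1 (fun x => h (s0 * (x - y0))) (s0 * h^`()%classic (s0 * (x - y0))).
  move=> sh; have := @is_derive1_comp _ h (fun x => s0 * (x - y0)) x _ _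
    (smooth_is_derive (s0 * (x - y0)) sh).
  move=> /(_ s0) Hh; rewrite mulrC; apply: Hh.
  have := is_deriveZ s0 (is_deriveB (is_derive_id x (1 : R)) (is_derive_cst y0 x 1)).
  by rewrite subr0 /GRing.scale/= mulr1.
apply: is_derive_eq (is_deriveD (is_deriveZ _ (H f' s y sf')) (is_deriveZ _ (H g' t z sg'))) _.
by rewrite /GRing.scale/= !mulrA.
Qed.

Definition bump_gap x : R := 1 - x ^+ 2.

(** The derivatives of [exp (- 1 / (1 - x^2))], extended by 0, all have this
form: p is a polynomial and k counts the powers of [1 / (1 - x^2)]. *)
Definition bump_family p (k : nat) x : R :=
  if `|x| < 1 then p.[x] * ((bump_gap x)^-1 ^+ k * expR (- (bump_gap x)^-1)) else 0.

Lemma bump_gap_gt0 x : `|x| < 1 -> 0 < bump_gap x.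
Proof.
by move=> x1; rewrite /bump_gap subr_gt0 -real_normK ?num_real// expr_lt1.
Qed.

Lemma bump_gap_le x a : `|x| < 1 -> 1 <= `|a| -> bump_gap x <= 2 * `|x - a|.
Proof.
move=> x1 a1; rewrite /bump_gap.
have : 1 - `|x| <= `|x - a|.
  rewrite distrC; apply: le_trans (lerB_dist _ _); lra.
rewrite -[x ^+ 2]real_normK ?num_real//.
have := normr_ge0 x; set t := `|x| in x1 *; set d := `|x - a| => t0 h.
nra.
Qed.

(** The exponential series dominates each of its terms; the term of degree
[k.+2] leaves the two powers of s that make [bump_family] flat at the boundary
of its support. *)
Lemma expR_decay (k : nat) (s : R) : 0 < s -> s^-1 ^+ k * expR (- s^-1) <= k.+2`!%:R * s ^+ 2.
Proof.
move=> s0; rewrite expRN.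
have h := @expR_ge1Dxn R s^-1 k.+1 (ltW (etrans (invr_gt0 _) s0)).
have f0 : 0 < (k.+2`!%:R : R) by rewrite ltr0n fact_gt0.
have h2 : s^-1 ^+ k.+2 / k.+2`!%:R <= expR s^-1 by apply: le_trans h; rewrite lerDr.
rewrite ler_pdivrMr ?expR_gt0//.
have -> : s^-1 ^+ k = (k.+2`!%:R * s ^+ 2) * (s^-1 ^+ k.+2 / k.+2`!%:R).
  by rewrite !exprS; field; rewrite ?gt_eqF.
by rewrite ler_pM2l// mulr_gt0// exprn_gt0.
Qed.

Lemma poly_bounded_on_ball p : exists2 C : R, 0 <= C & forall x, `|x| < 1 -> `|p.[x]| <= C.
Proof.
exists (\sum_(i < size p) `|p`_i|); first exact: sumr_ge0.
move=> x x1; rewrite horner_coef; apply: le_trans (ler_norm_sum _ _ _) _.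
apply: ler_sum => i _; rewrite normrM normrX ler_piMr// exprn_ile1//.
exact: ltW.
Qed.

(** Quadratic decay towards each point a outside the open unit ball, with a
constant independent of a: the derivative at such a point is 0, whether or not
the point lies on the boundary of the support. *)
Lemma bump_family_flat p k : exists2 C : R, 0 <= C &
  forall x a, 1 <= `|a| -> `|bump_family p k x| <= C * (x - a) ^+ 2.
Proof.
have [C C0 HC] := poly_bounded_on_ball p.
exists (C * (k.+2`!%:R * 4)); first by rewrite !mulr_ge0.
move=> x a a1; rewrite /bump_family; case: ifPn => [x1|_]; last first.
  by rewrite normr0 mulr_ge0 ?sqr_ge0// !mulr_ge0.
rewrite normrM -!mulrA; apply: ler_pM => //; first exact: HC.
have w0 := bump_gap_gt0 x1.
rewrite ger0_norm; last by rewrite mulr_ge0 ?expR_ge0// exprn_ge0// invr_ge0 ltW.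
apply: le_trans (expR_decay k w0) _; rewrite ler_pM2l ?ltr0n ?fact_gt0//.
have := bump_gap_le x1 a1; rewrite -[(x - a) ^+ 2]real_normK ?num_real//.
set d := `|x - a|; move=> h; nra.
Qed.

(** The numerator produced by the product rule, all terms being brought to the
common denominator [(1 - x^2) ^ k.+2]. *)
Definition bump_family_deriv p (k : nat) : {poly R} :=
  p^`() * (1 - 'X^2) ^+ 2 + k%:R *: (p * (2 *: 'X) * (1 - 'X^2)) - p * (2 *: 'X).

Lemma is_derive_bump_family p k x :
  is_derive x 1 (bump_family p k) (bump_family (bump_family_deriv p k) k.+2 x).
Proof.
have [x1|x1] := ltP `|x| 1; last first.
  have [C C0 HC] := bump_family_flat p k.
  have F0 : bump_family p k x = 0 by rewrite /bump_family ltNge x1.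
  have -> : bump_family (bump_family_deriv p k) k.+2 x = 0 by rewrite /bump_family ltNge x1.
  have H : h^-1 *: ((bump_family p k \o shift x) (h *: (1 : R)) - bump_family p k x)
      @[h --> 0^'] --> (0 : R).
    apply/cvgrPdist_le => e e0; near=> h.
    have h0 : h != 0 by near: h; exact: nbhs_dnbhs_neq.
    have hC : `|h| <= e / (C + 1).
      near: h; apply: dnbhs0_le; rewrite divr_gt0// ltr_wpDl//.
    rewrite F0 subr0 sub0r normrN /shift/= [h%:A]mulr1 /GRing.scale/= normrM normfV.
    rewrite ler_pdivrMl ?normr_gt0//.
    apply: le_trans (HC _ _ x1) _; rewrite addrK -real_normK ?num_real//.
    move: hC; rewrite ler_pdivlMr; last by rewrite ltr_wpDl.
    have := normr_ge0 h; set d := `|h|; nra.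
  apply: DeriveDef; first by apply/cvg_ex; exists 0.
  by apply/cvg_lim => //; exact: Rhausdorff.
have w0 := bump_gap_gt0 x1.
have wd : is_derive x 1 bump_gap (- (2 * x)).
  have H := is_deriveB (is_derive_cst (1:R) x 1) (is_deriveX 2 (is_derive_id x (1:R))).
  by apply: (is_derive_eq H); rewrite /GRing.scale/= expr1 mulr1 sub0r.
have iwd : is_derive x 1 (fun y => (bump_gap y)^-1) (2 * x * (bump_gap x)^-1 ^+ 2).
  have H := is_deriveV (lt0r_neq0 w0) wd.
  by apply: (is_derive_eq H); rewrite /GRing.scale/= exprVn; ring.
have H1 := is_deriveX k iwd.
have H2 := is_derive1_comp (is_derive_expR _) (is_deriveN iwd).
have H := is_deriveM (is_derive_poly p x) (is_deriveM H1 H2).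
apply: near_eq_is_derive (is_derive_eq H _).
  have ox : open [set y : R | `|y| < 1].
    exact: (@open_comp _ _ (fun y : R => `|y|) [set y | y < 1]
      (fun y _ => @norm_continuous _ _ y) (@open_lt _ 1)).
  near=> y; rewrite /bump_family ifT//; last by near: y; exact: open_nbhs_nbhs.
  by rewrite !fctE.
rewrite /bump_family x1 /bump_family_deriv !fctE.
rewrite !(hornerD, hornerN, hornerM, hornerZ, horner_exp, hornerX, hornerC).
have -> : 1 - x ^+ 2 = bump_gap x by [].
rewrite /GRing.scale.
cbn -[GRing.mul GRing.exp GRing.inv GRing.add GRing.opp GRing.one GRing.natmul
  bump_gap expR].
have wv : bump_gap x * (bump_gap x)^-1 = 1 by rewrite mulfV// gt_eqF.
move: wv; set v := (bump_gap x)^-1; set w := bump_gap x; set e := expR _ => wv.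
have -> : v ^+ k.+2 = v ^+ k * v ^+ 2 by rewrite -exprD addn2.
have -> : k%:R * v ^+ k.-1 = k%:R * v ^+ k * w.
  case: (k) => [|k']; first by rewrite !mul0r.
  by rewrite exprS; transitivity (k'.+1%:R * v ^+ k' * (w * v)); [rewrite wv mulr1|ring].
by ring: wv.
Unshelve. all: by end_near. Qed.

Lemma smooth_bump_family p k : smooth (bump_family p k).
Proof.
apply: (@smooth_closed [set f | exists p k, f = bump_family p k]); last by exists p, k.
move=> _ [q [l ->]]; exists (bump_family (bump_family_deriv q l) l.+2).
  by exists (bump_family_deriv q l), l.+2.
by move=> x; exact: is_derive_bump_family.
Qed.

Lemma smooth_continuous f : smooth f -> continuous f.
Proof.
move=> sf x; apply/differentiable_continuous/derivable1_diffP.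
exact: (sf 0%N).
Qed.

Local Notation mu := (@lebesgue_measure R).

Lemma supp_integrable (h : R -> R) (a b : R) : continuous h ->
  (forall x, ~ `[a, b]%classic x -> h x = 0) -> mu.-integrable setT (EFin \o h).
Proof.
move=> ch h0.
have : mu.-integrable `[a, b] (EFin \o h).
  apply: continuous_compact_integrable; first exact: segment_compact.
  exact: continuous_subspaceT.
rewrite integrable_mkcond//; apply: eq_integrable => // x _.
by rewrite /patch; case: ifPn => // /negP; rewrite inE => /h0 /= ->.
Qed.

Definition bump : R -> R := bump_family 1 0.

Lemma bumpE x : `|x| < 1 -> bump x = expR (- (bump_gap x)^-1).
Proof. by move=> x1; rewrite /bump /bump_family x1 hornerC !mul1r. Qed.

Lemma bump_out x : 1 <= `|x| -> bump x = 0.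
Proof. by move=> x1; rewrite /bump /bump_family ltNge x1. Qed.

Lemma bump_ge0 x : 0 <= bump x.
Proof.
by have [/bump_out->//|/bumpE->] := leP 1 `|x|; exact: expR_ge0.
Qed.

Lemma bump_le1 x : bump x <= 1.
Proof.
have [/bump_out->//|x1] := leP 1 `|x|.
by rewrite bumpE// -expR0 ler_expR oppr_le0 invr_ge0 ltW// bump_gap_gt0.
Qed.

Lemma smooth_bump : smooth bump. Proof. exact: smooth_bump_family. Qed.

Lemma bump_integrable : mu.-integrable setT (EFin \o bump).
Proof.
apply: (@supp_integrable _ (-1) 1); first exact/smooth_continuous/smooth_bump.
move=> x /=; rewrite in_itv/= -ler_norml => /negP; rewrite -ltNge => x1.
by rewrite bump_out// ltW.
Qed.

Definition step x : R := \int[mu]_(t in `]-oo, x]) bump t.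

Lemma is_derive_step x : is_derive x 1 step (bump x).
Proof.
have := @continuous_FTC1 R bump -oo%O x (x + 1).
case.
- by rewrite ltrDl.
- apply: (integrableS _ _ _ bump_integrable) => //; exact: measurable_itv.
- by rewrite ltNyr.
- exact/smooth_continuous/smooth_bump.
- move=> d1 d2; apply: DeriveDef; first exact: d1.
  by rewrite -derive1E.
Qed.

Lemma smooth_step : smooth step.
Proof.
apply: (@smooth_closed [set f | f = step \/ exists p k, f = bump_family p k]); last by left.
move=> _ [->|[q [l ->]]].
  by exists bump; [right; exists 1, 0%N|exact: is_derive_step].
exists (bump_family (bump_family_deriv q l) l.+2).
  by right; exists (bump_family_deriv q l), l.+2.
by move=> x; exact: is_derive_bump_family.
Qed.

Lemma step_left x : x <= -1 -> step x = 0.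
Proof.
move=> x1; rewrite /step -[RHS](@Rintegral_set0 _ _ R mu (fun=> 0)).
rewrite Rintegral_mkcond [RHS]Rintegral_mkcond; apply: eq_Rintegral => t _.
rewrite /patch in_set0; case: ifPn => //; rewrite inE/= in_itv/= => tx.
by rewrite bump_out// ler_normr; apply/orP; right; lra.
Qed.

Definition step_top : R := \int[mu]_t bump t.

Lemma step_right x : 1 <= x -> step x = step_top.
Proof.
move=> x1; rewrite /step Rintegral_mkcond; apply: eq_Rintegral => t _.
rewrite /patch; case: ifPn => //; rewrite notin_setE/= in_itv/= => /negP; rewrite -ltNge => tx.
by rewrite bump_out// ler_normr; apply/orP; left; lra.
Qed.

Lemma step_MVT (a b : R) : a < b -> exists2 c, a < c < b & step b - step a = bump c * (b - a).
Proof.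
move=> ab; have [||c cab ->] := @MVT R step bump a b ab.
- by move=> x _; exact: is_derive_step.
- exact/continuous_subspaceT/smooth_continuous/smooth_step.
- by exists c => //; move: cab; rewrite in_itv.
Qed.

Lemma step_le (a b : R) : a <= b -> step a <= step b.
Proof.
rewrite le_eqVlt => /predU1P[->//|ab]; have [c _] := step_MVT ab.
by move=> h; rewrite -subr_ge0 h mulr_ge0 ?bump_ge0// subr_ge0 ltW.
Qed.

Lemma step_ge0 x : 0 <= step x.
Proof.
have [/step_left->//|x1] := leP x (-1).
by rewrite -(@step_left (-1))// step_le// ltW.
Qed.

Lemma step_le_top x : step x <= step_top.
Proof.
have [/step_right->//|x1] := leP 1 x.
by rewrite -(@step_right 1)// step_le// ltW.
Qed.

Lemma step_top_gt0 : 0 < step_top.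
Proof.
have [c /andP[c0 c1] h] := @step_MVT 0 1 ltr01.
rewrite -(step_right (lexx 1)) -(subrK (step 0) (step 1)) h.
rewrite ltr_pwDl ?step_ge0// mulr_gt0// ?subr0//.
by rewrite bumpE ?expR_gt0// ger0_norm// ltW.
Qed.

Lemma test_functionP f (a b : R) : smooth f -> (forall x, ~ `[a, b]%classic x -> f x = 0) ->
  test_function f.
Proof.
move=> sf f0; split=> //.
apply: (@subclosed_compact _ _ `[a, b]%classic).
- exact: closed_closure.
- exact: segment_compact.
- rewrite [X in _ `<=` X](_ : _ = closure `[a, b]%classic).
    by apply: closure_subset => x /= /eqP fx; apply: contrapT => /f0.
  by apply/closure_id; exact: itv_closed.
Qed.

Definition bump_at (d x t : R) : R := bump (d^-1 * (t - x)).
(** A smooth substitute for [step_top] times the indicator of [[x, y]]; its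
derivative is a difference of two approximate point masses. *)
Definition plateau (d x y t : R) : R := step (d^-1 * (t - x)) - step (d^-1 * (t - y)).

Lemma bump_at_out d x t : 0 < d -> ~ ball x d t -> bump_at d x t = 0.
Proof.
move=> d0; rewrite /ball/= => /negP; rewrite -leNgt distrC => h.
by rewrite /bump_at bump_out// normrM (gtr0_norm (etrans (invr_gt0 _) d0)) ler_pdivlMl// mulr1.
Qed.

Lemma smooth_bump_at d x : smooth (bump_at d x).
Proof.
have := @smooth_affine_comb bump bump 1 0 d^-1 0 x 0 smooth_bump smooth_bump.
by congr smooth; apply/funext => t; rewrite mul1r mul0r addr0.
Qed.

Lemma test_bump_at d x : 0 < d -> test_function (bump_at d x).
Proof.
move=> d0; apply: (@test_functionP _ (x - d) (x + d)); first exact: smooth_bump_at.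
move=> t xdt; apply: bump_at_out => //; apply: contra_not xdt.
by rewrite ball_itv; apply: subset_itvW.
Qed.

Lemma smooth_plateau d x y : smooth (plateau d x y).
Proof.
have := @smooth_affine_comb step step 1 (-1) d^-1 d^-1 x y smooth_step smooth_step.
by congr smooth; apply/funext => t; rewrite mul1r mulN1r.
Qed.

Lemma plateau_out d x y t : 0 < d -> x <= y ->
  ~ `[x - d, y + d]%classic t -> plateau d x y t = 0.
Proof.
move=> d0 xy; rewrite /= in_itv/= => /negP; rewrite negb_and -!ltNge /plateau => /orP[h|h].
  rewrite !step_left ?subrr// ler_pdivrMl// mulrN1; lra.
rewrite !step_right ?subrr// ler_pdivlMl// mulr1; lra.
Qed.

Lemma test_plateau d x y : 0 < d -> x <= y -> test_function (plateau d x y).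
Proof.
move=> d0 xy; apply: (@test_functionP _ (x - d) (y + d)); first exact: smooth_plateau.
by move=> t; exact: plateau_out.
Qed.

Lemma plateau_le d x y t : `|plateau d x y t| <= step_top.
Proof.
have := step_ge0 (d^-1 * (t - x)); have := step_ge0 (d^-1 * (t - y)).
have := step_le_top (d^-1 * (t - x)); have := step_le_top (d^-1 * (t - y)).
rewrite /plateau ler_norml => *; apply/andP; split; lra.
Qed.

Lemma is_derive_stepat d x t :
  is_derive t 1 (fun t => step (d^-1 * (t - x))) (d^-1 * bump_at d x t).
Proof.
have H0 := is_deriveZ d^-1 (is_deriveB (is_derive_id t (1 : R)) (is_derive_cst x t 1)).
have H := is_derive1_comp (is_derive_step _) H0.
by apply: (is_derive_eq H); rewrite /GRing.scale/= subr0 mulr1 mulrC.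
Qed.

Lemma derive_plateau d x y t :
  (plateau d x y)^`()%classic t = d^-1 * bump_at d x t - d^-1 * bump_at d y t.
Proof.
rewrite derive1E; apply: derive_val.
exact: is_deriveB (is_derive_stepat _ _ _) (is_derive_stepat _ _ _).
Qed.

Lemma Rintegral_derive_supp (F f : R -> R) (a b : R) : a < b ->
  (forall x, is_derive x 1 F (f x)) -> continuous f ->
  (forall x, ~ `[a, b]%classic x -> f x = 0) ->
  \int[mu]_t f t = F b - F a.
Proof.
move=> ab dF cf f0.
have cF : continuous F.
  move=> x; apply/differentiable_continuous/derivable1_diffP.
  exact: ex_derive.
transitivity (\int[mu]_(t in `[a, b]) f t).
  rewrite [RHS]Rintegral_mkcond; apply: eq_Rintegral => t _.
  by rewrite /patch; case: ifPn => // /negP; rewrite inE => /f0.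
rewrite /Rintegral (@continuous_FTC2 _ f F)//.
- exact: continuous_subspaceT.
- split=> [x _||]; first exact: ex_derive.
  + exact/cvg_at_right_filter/cF.
  + exact/cvg_at_left_filter/cF.
- by move=> x _; rewrite derive1E; apply: derive_val.
Qed.

Lemma Rintegral_bump_at d x : 0 < d -> \int[mu]_t bump_at d x t = d * step_top.
Proof.
move=> d0.
have dF t : is_derive t 1 (fun t => d * step (d^-1 * (t - x))) (bump_at d x t).
  apply: is_derive_eq (is_deriveZ d (is_derive_stepat d x t)) _.
  by rewrite /GRing.scale/= mulrA divff ?mul1r// gt_eqF.
rewrite (Rintegral_derive_supp _ dF (a := x - d) (b := x + d)).
- rewrite addrAC subrr add0r mulVf ?gt_eqF// step_right// addrAC subrr add0r.
  by rewrite mulrN mulVf ?gt_eqF// step_left// mulr0 subr0.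
- lra.
- exact/smooth_continuous/smooth_bump_at.
- move=> t xdt; apply: bump_at_out => //; apply: contra_not xdt.
  by rewrite ball_itv; apply: subset_itvW.
Qed.

End Bump.

(** * Weak derivatives at Lebesgue points *)

Section Weak.
Context {R : realType}.
Local Notation mu := (@lebesgue_measure R).
Implicit Types (f g u v h : R -> R) (x y t d s : R).

Lemma Lfun2P f : (f \in Lfun mu 2%:E) <->
  measurable_fun setT f /\ (\int[mu]_x (f x ^+ 2)%:E < +oo)%E.
Proof.
split=> [fL|[mf fi]].
  have mf : measurable_fun setT f.
    by move: fL; rewrite inE => /andP[]; rewrite inE.
  split=> //; have /integrableP[_] := Lfun2_integrable_sqr fL.
  by under eq_integral do rewrite /= ger0_norm ?sqr_ge0//.
rewrite inE; apply/andP; split; first by rewrite inE.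
rewrite inE/= /finite_norm unlock poweR_lty//.
apply: le_lt_trans fi; rewrite le_eqVlt; apply/orP; left; apply/eqP.
by apply: eq_integral => x _ /=; rewrite powR_mulrn// real_normK// num_real.
Qed.

Lemma sqr_integrable f : measurable_fun setT f ->
  (\int[mu]_x (f x ^+ 2)%:E < +oo)%E -> mu.-integrable setT (fun x => (f x ^+ 2)%:E).
Proof.
move=> mf fi; apply/integrableP; split; first exact/measurable_EFinP/measurable_funX.
by under eq_integral do rewrite gee0_abs ?lee_fin ?sqr_ge0//.
Qed.

Lemma supp_bounded h (a b : R) : continuous h ->
  (forall x, ~ `[a, b]%classic x -> h x = 0) -> [bounded h x | x in [set: R]].
Proof.
move=> ch h0.
have /compact_bounded[M [Mr HM]] : compact (h @` `[a, b]).
  apply: continuous_compact; last exact: segment_compact.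
  exact: continuous_subspaceT.
exists `|M|; split=> // M' MM' x _ /=.
have [xab|/h0->] := pselect (`[a, b]%classic x); last first.
  by rewrite normr0; apply: le_trans (ltW MM').
by apply: HM; [exact: le_lt_trans (ler_norm _) MM'|exists x].
Qed.

Lemma locally_integrable_mul f h (a b : R) : locally_integrable setT f -> continuous h ->
  (forall x, ~ `[a, b]%classic x -> h x = 0) ->
  mu.-integrable setT (fun x => (f x * h x)%:E).
Proof.
move=> [mf _ fi] ch h0.
have fab : mu.-integrable `[a, b] (EFin \o f).
  apply/integrableP; split.
    by apply/measurable_EFinP; exact: measurable_funTS.
  by apply: fi => //; exact: segment_compact.
have : mu.-integrable `[a, b] ((EFin \o f) \* (EFin \o h))%E.
  apply: integrableMl => //.
    by apply: measurable_funTS; exact: continuous_measurable_fun.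
  have [M [Mr HM]] := supp_bounded ch h0.
  by exists M; split => // M' MM' x _; exact: HM.
rewrite integrable_mkcond//; apply: eq_integrable => // x _.
by rewrite /patch; case: ifPn => // /negP; rewrite inE => /h0 /= ->; rewrite mulr0.
Qed.

Lemma locally_integrable_bump_at f d x : locally_integrable setT f -> 0 < d ->
  mu.-integrable setT (fun t => (f t * bump_at d x t)%:E).
Proof.
move=> lf d0; apply: (@locally_integrable_mul _ _ (x - d) (x + d)) => //.
  exact/smooth_continuous/smooth_bump_at.
move=> t xdt; apply: bump_at_out => //; apply: contra_not xdt.
by rewrite ball_itv; apply: subset_itvW.
Qed.

Lemma locally_integrable_cst (c : R) : locally_integrable setT (fun _ : R => c).
Proof.
split=> //; first exact: openT.
move=> K _ cK; rewrite integral_cst/=; last exact: compact_measurable.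
by rewrite lte_mul_pinfty ?lee_fin//; exact: compact_finite_measure.
Qed.

(** The bump is at most 1 and vanishes outside the ball of radius d, so the
error is controlled by the mean oscillation over that ball, whose length is
[2 * d]. *)
Lemma bump_avg_le f x d : locally_integrable setT f -> 0 < d ->
  davg f x d \is a fin_num ->
  `|d^-1 * \int[mu]_t (f t * bump_at d x t) - f x * step_top| <= 2 * fine (davg f x d).
Proof.
move=> lf d0 fin.
have if1 := locally_integrable_bump_at x lf d0.
have if2 := locally_integrable_bump_at x (locally_integrable_cst (f x)) d0.
have lB : locally_integrable setT (fun t => f t - f x).
  exact: locally_integrableB lf (locally_integrable_cst (f x)).
have if3 := locally_integrable_bump_at x lB d0.
have -> : d^-1 * \int[mu]_t (f t * bump_at d x t) - f x * step_top =
   d^-1 * \int[mu]_t ((f t - f x) * bump_at d x t).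
  under [in RHS]eq_Rintegral do rewrite mulrBl.
  rewrite RintegralB// RintegralZl//; last first.
    by have := locally_integrable_bump_at x (locally_integrable_cst 1) d0; under eq_fun do rewrite mul1r.
  by rewrite Rintegral_bump_at//; field; rewrite gt_eqF.
rewrite normrM gtr0_norm ?invr_gt0// ler_pdivrMl//.
have muB : mu (ball x d) = (d *+ 2)%:E by rewrite lebesgue_measure_ball// ltW.
have IE : (\int[mu]_(t in ball x d) `|(f t - f x)%:E| = (2 * d)%:E * davg f x d)%E.
  rewrite /davg /iavg muB inver mulrn_eq0/= gt_eqF// muleA -EFinM.
  by rewrite (_ : 2 * d * (d *+ 2)^-1 = 1) ?mul1e//; field; rewrite gt_eqF.
have -> : d * (2 * fine (davg f x d)) = fine ((2 * d)%:E * davg f x d)%E.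
  by rewrite -[davg _ _ _]fineK// -EFinM/= mulrCA mulrA.
rewrite -IE; apply: (le_trans (le_normr_Rintegral _ if3)) => //.
rewrite /Rintegral fine_le//.
- by apply: integrable_fin_num => //; exact: integrable_norm if3.
- by rewrite IE fin_numM.
rewrite [leRHS]integral_mkcond; apply: ge0_le_integral => //.
- by have /integrableP[+ _] := integrable_norm if3.
- apply/measurable_restrict => //; first exact: measurable_ball.
  apply: measurable_funTS; apply/measurable_EFinP; apply: measurableT_comp => //.
  by case: lB.
- move=> t _; rewrite /patch; case: ifPn => [_|].
    by rewrite lee_fin normrM ler_piMr// ger0_norm ?bump_le1 ?bump_ge0.
  by rewrite notin_setE => /(bump_at_out d0) ->; rewrite mulr0 normr0.
Qed.

(** Pointwise values can be recovered from integrals against test functions. *)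
Lemma bump_avg_cvg f x : locally_integrable setT f -> lebesgue_pt f x ->
  d^-1 * \int[mu]_t (f t * bump_at d x t) @[d --> 0^'+] --> f x * step_top.
Proof.
move=> lf /fine_cvgP[fin cv].
apply/cvgrPdist_le => e e0; near=> d.
have d0 : 0 < d by near: d; exact: nbhs_right_gt.
rewrite distrC; apply: le_trans (bump_avg_le lf d0 _) _; first by near: d.
rewrite mulrC -ler_pdivlMr//; near: d.
have := cvgr_le _ cv; apply; exact: divr_gt0.
Unshelve. all: by end_near. Qed.

(** At a Lebesgue point of the difference, its averages against bumps vanish,
since bumps are test functions, and converge to a nonzero multiple of its
value. *)
Lemma weak_derivative_unique u g1 g2 : weak_derivative u g1 -> weak_derivative u g2 ->
  {ae mu, forall x, g1 x = g2 x}.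
Proof.
move=> [_ l1 h1] [_ l2 h2].
have lB := locally_integrableB l1 l2.
have := lebesgue_differentiation lB.
apply: filterS; first exact: (ae_filter_ringOfSetsType mu).
move=> x /(bump_avg_cvg lB) cv.
have : d^-1 * \int[mu]_t ((g1 \- g2) t * bump_at d x t) @[d --> 0^'+] --> (0 : R).
  apply/cvgrPdist_le => e e0; near=> d.
  have d0 : 0 < d by near: d; exact: nbhs_right_gt.
  under eq_Rintegral do rewrite mulrBl.
  rewrite RintegralB//; [|exact: locally_integrable_bump_at..].
  suff -> : \int[mu]_t (g1 t * bump_at d x t) = \int[mu]_t (g2 t * bump_at d x t).
    by rewrite subrr mulr0 subrr normr0 ltW.
  by apply: oppr_inj; rewrite -h1 ?h2//; exact: test_bump_at.
move=> /(cvg_unique (@Rhausdorff R)) => /(_ _ cv)/esym/eqP.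
rewrite mulf_eq0 (gt_eqF step_top_gt0) orbF /= subr_eq0 => /eqP; exact.
Unshelve. all: by end_near. Qed.

(** Young's inequality with a free weight s plays the role of the
Cauchy-Schwarz inequality. *)
Lemma l2_pairing_le g phi (a b c s : R) : locally_integrable setT g ->
  g \in Lfun mu 2%:E -> continuous phi -> a <= b -> 0 < s ->
  (forall x, ~ `[a, b]%classic x -> phi x = 0) -> (forall x, `|phi x| <= c) ->
  `| \int[mu]_x (g x * phi x) | <=
  2^-1 * (s * (\int[mu]_x (g x ^+ 2)) + s^-1 * (c ^+ 2 * (b - a))).
Proof.
move=> lg /Lfun2P[mg ig] cphi ab s0 phi0 phic.
have c0 : 0 <= c by apply: le_trans (phic 0).
have i1 := locally_integrable_mul lg cphi phi0.
have i2 := sqr_integrable mg ig.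
have i3 : mu.-integrable setT (fun x => (c ^+ 2 * \1_(`[a, b]) x)%:E).
  have := @integrable_indic_itv R a b true false.
  by move=> /(integrableZl measurableT (c ^+ 2)); under eq_fun do rewrite -EFinM.
have -> : c ^+ 2 * (b - a) = \int[mu]_x (c ^+ 2 * \1_(`[a, b]) x).
  rewrite RintegralZl//; last exact: (@integrable_indic_itv R a b true false).
  rewrite /Rintegral integral_indic//.
  rewrite setIT [X in fine X](lebesgue_measure_itv `[a, b])/= lte_fin.
  by case: ltP => //= ba; congr (_ * _); apply/eqP; rewrite subr_eq0 eq_le ba ab.
rewrite -!RintegralZl// -RintegralD//; last 2 first.
- by have := integrableZl measurableT s i2.
- by have := integrableZl measurableT s^-1 i3.
have i4 : mu.-integrable setT
   (fun x => (s * g x ^+ 2 + s^-1 * (c ^+ 2 * \1_(`[a, b]) x))%:E).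
  by have := integrableD measurableT (integrableZl measurableT s i2) (integrableZl measurableT s^-1 i3).
rewrite -RintegralZl//.
apply: (le_trans (le_normr_Rintegral _ i1)) => //.
apply: le_Rintegral => //.
- exact: integrable_norm i1.
- by have := integrableZl measurableT 2^-1 i4.
move=> x _; rewrite indicE normrM.
have amgm (p q : R) : 0 <= p -> p * q <= 2^-1 * (s * p ^+ 2 + s^-1 * q ^+ 2).
  move=> _; have : 0 <= s^-1 * (s * p - q) ^+ 2 by rewrite mulr_ge0 ?invr_ge0 ?sqr_ge0// ltW.
  have -> : s^-1 * (s * p - q) ^+ 2 = s * p ^+ 2 + s^-1 * q ^+ 2 - 2 * p * q.
    by field; rewrite gt_eqF.
  by move=> h; lra.
apply: le_trans (amgm _ _ (normr_ge0 _)) _.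
rewrite ler_pM2l// real_normK ?num_real// lerD2l ler_pM2l ?invr_gt0//.
have [xab|/negP] := boolP (x \in `[a, b]%classic).
  by rewrite mulr1 ler_sqr ?nnegrE.
by rewrite inE => /phi0->; rewrite normr0 expr0n/= mulr0.
Qed.

Lemma weak_derivative_test_bound u g phi (a b c s : R) : weak_derivative u g ->
  g \in Lfun mu 2%:E -> test_function phi -> a <= b -> 0 < s ->
  (forall x, ~ `[a, b]%classic x -> phi x = 0) -> (forall x, `|phi x| <= c) ->
  `| \int[mu]_x (u x * (phi^`())%classic x) | <=
  2^-1 * (s * (\int[mu]_x (g x ^+ 2)) + s^-1 * (c ^+ 2 * (b - a))).
Proof.
move=> [lu lg hg] gL tphi ab s0 phi0 phic; rewrite hg// normrN.
by apply: l2_pairing_le => //; apply: smooth_continuous; case: tphi.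
Qed.

(** A plateau between x and y, tested against u, gives the difference of the
two averages of u; its pairing with g is at most of order the square root of
the length of the support. *)
Lemma weak_derivative_holder u g (x y : R) : weak_derivative u g ->
  g \in Lfun mu 2%:E -> lebesgue_pt u x -> lebesgue_pt u y ->
  `|u x - u y| <= (\int[mu]_x (g x ^+ 2) + 1) * Num.sqrt `|x - y|.
Proof.
move=> wg gL.
wlog xy : x y / x <= y.
  move=> H; have [xy|/ltW yx] := leP x y; first exact: H.
  by move=> *; rewrite distrC (distrC x); exact: H.
rewrite le_eqVlt in xy; move: xy => /predU1P[->|xy] Lx Ly.
  by rewrite !subrr normr0 sqrtr0 mulr0.
have lu : locally_integrable setT u by case: wg.
set G := \int[mu]_x (g x ^+ 2).
have G0 : 0 <= G by apply: Rintegral_ge0 => ? _; exact: sqr_ge0.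
(* This weight balances the two terms of [weak_derivative_test_bound]. *)
pose s := Num.sqrt (y - x) * step_top.
have r0 : 0 < Num.sqrt (y - x) by rewrite sqrtr_gt0 subr_gt0.
have c0 := @step_top_gt0 R.
have s0 : 0 < s by rewrite mulr_gt0.
pose F d := 2^-1 * (s * G + s^-1 * (step_top ^+ 2 * (y - x + 2 * d))).
have FL : F d @[d --> 0^'+] --> F 0.
  apply: cvg_at_right_filter; rewrite /F.
  apply: cvgM; first exact: cvg_cst.
  apply: cvgD; first exact: cvg_cst.
  apply: cvgM; first exact: cvg_cst.
  apply: cvgM; first exact: cvg_cst.
  apply: cvgD; first exact: cvg_cst.
  by apply: cvgM; [exact: cvg_cst|exact: cvg_id].
have L := cvg_norm (cvgB (bump_avg_cvg lu Lx) (bump_avg_cvg lu Ly)).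
have : `|u x * step_top - u y * step_top| <= F 0.
  apply: (ler_cvg_to (L _ _) FL); near=> d.
  have d0 : 0 < d by near: d; exact: nbhs_right_gt.
  have i1 := locally_integrable_bump_at x lu d0.
  have i2 := locally_integrable_bump_at y lu d0.
  have := @weak_derivative_test_bound u g (plateau d x y) (x - d) (y + d) step_top s wg gL
    (test_plateau d0 (ltW xy)) _ s0 (fun t => plateau_out d0 (ltW xy)) (plateau_le d x y).
  rewrite (_ : y + d - (x - d) = y - x + 2 * d); last by ring.
  rewrite -/G -/(F d) => h; apply: le_trans (h _); last by lra.
  rewrite le_eqVlt; apply/orP; left; apply/eqP; congr (`|_|).
  rewrite -[LHS]/(d^-1 * \int[mu]_t (u t * bump_at d x t) -
    d^-1 * \int[mu]_t (u t * bump_at d y t)).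
  rewrite -!RintegralZl// -RintegralB//; last 2 first.
  - by have := integrableZl measurableT d^-1 i1.
  - by have := integrableZl measurableT d^-1 i2.
  by apply: eq_Rintegral => t _; rewrite derive_plateau mulrBr !(mulrCA (u t)).
rewrite -mulrBl normrM (gtr0_norm c0) -ler_pdivlMr// => h.
apply: le_trans h _; rewrite /F /s mulr0 addr0 distrC (gtr0_norm (etrans (subr_gt0 _ _) xy)).
have : y - x = Num.sqrt (y - x) ^+ 2 by rewrite sqr_sqrtr// subr_ge0 ltW.
move: r0; set r := Num.sqrt _ => r0 ->.
have -> : 2^-1 * (r * step_top * G + (r * step_top)^-1 * (step_top ^+ 2 * r ^+ 2)) / step_top =
   2^-1 * (r * G + r).
  by field; rewrite !gt_eqF.
have : 0 <= r * G by rewrite mulr_ge0// ltW.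
by rewrite mulrDl mul1r mulrC => ?; lra.
Unshelve. all: by end_near. Qed.

End Weak.

(** * Almost everywhere limits *)

Section Limits.
Context d (T : measurableType d) {R : realType} (mu : {measure set T -> \bar R}).

(** Replacing the functions by 0 on a measurable null set makes the sequence
converge everywhere, hence the limit measurable. *)
Lemma ae_cvg_measurable (f : nat -> T -> R) :
  (forall n, measurable_fun setT (f n)) ->
  {ae mu, forall x, cvgn (f ^~ x)} ->
  exists2 g : T -> R, measurable_fun setT g & {ae mu, forall x, f ^~ x @ \oo --> g x}.
Proof.
move=> mf [N [mN N0 subN]].
pose h n := f n \_ (~` N).
have hc x : cvgn (h ^~ x).
  have [xN|xN] := pselect (N x).
    have -> : h ^~ x = cst 0.
      by apply/funext => n; rewrite /h /patch memNset.
    exact: is_cvg_cst.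
  have -> : h ^~ x = f ^~ x by apply/funext => n; rewrite /h /patch mem_set.
  by apply: contrapT => xc; apply: xN; exact: subN.
exists (fun x => limn (h ^~ x)).
  apply: (@measurable_fun_cvg _ _ _ _ h) => [n|x _]; last exact: hc.
  apply/(measurable_restrict _ (measurableC mN)) => //.
  by apply: measurable_funS (mf n).
exists N; split=> // x /=; apply: contra_notP => xN.
have -> : f ^~ x = h ^~ x by apply/funext => n; rewrite /h /patch mem_set.
exact: hc.
Qed.

Lemma cvg_sqr (w : nat -> R) (l : R) : w @ \oo --> l ->
  (fun n => w n ^+ 2) @ \oo --> l ^+ 2.
Proof.
move=> wl; rewrite expr2 (_ : (fun n => w n ^+ 2) = (fun n => w n * w n)).
  exact: cvgM.
by apply/funext => n; rewrite expr2.
Qed.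

Lemma fatou_ae (w : nat -> T -> R) (W : T -> R) :
  (forall n, measurable_fun setT (w n)) -> measurable_fun setT W ->
  (forall n x, 0 <= w n x) ->
  {ae mu, forall x, w ^~ x @ \oo --> W x} ->
  (\int[mu]_x (W x)%:E <= limn_einf (fun n => \int[mu]_x (w n x)%:E))%E.
Proof.
move=> mw mW w0 wW.
have mw' n : measurable_fun setT (EFin \o w n) by exact/measurable_EFinP.
have w0' n x : setT x -> (0 <= (EFin \o w n) x)%E by move=> _; rewrite lee_fin.
have := @fatou _ _ _ mu setT measurableT _ mw' w0'.
rewrite (ae_eq_integral (EFin \o W)) => //.
- rewrite (_ : (fun x => _) = -%E \o (fun x => limn_esup (fun n => - (w n x)%:E)%E)).
    have mN n : measurable_fun setT (fun x => (- (w n x)%:E)%E) by exact: measurableT_comp (mw' n).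
    exact: measurableT_comp (measurable_fun_limn_esup mN).
  by [].
- exact/measurable_EFinP.
- apply: filterS wW; move=> x wx _ /=.
  have : (EFin \o w ^~ x) @ \oo --> (W x)%:E by apply: cvg_EFin; [exact: nearW|].
  by move/cvg_limn_einf_sup => [].
Qed.

Lemma limn_einf_le_cvg (w : nat -> \bar R) (b : nat -> R) (B : R) :
  (forall n, w n <= (b n)%:E)%E -> b @ \oo --> B -> (limn_einf w <= B%:E)%E.
Proof.
move=> wb bB; have := @cvg_limn_einf_sup _ (EFin \o b) B%:E.
case; first by apply: cvg_EFin; [exact: nearW|].
move=> <- _; rewrite !limn_einf_lim; apply: lee_lim; [exact/is_cvg_einfs..|].
apply: nearW => n; apply: le_ereal_inf_tmp => _ [m /= nm <-].
by apply: ge_ereal_inf; exists (w m) => //; exists m.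
Qed.

Lemma fatou_cvg (w : nat -> T -> R) (W : T -> R) (b : nat -> R) (B : R) :
  (forall n, measurable_fun setT (w n)) -> measurable_fun setT W ->
  (forall n x, 0 <= w n x) ->
  {ae mu, forall x, w ^~ x @ \oo --> W x} ->
  (forall n, \int[mu]_x (w n x)%:E <= (b n)%:E)%E -> b @ \oo --> B ->
  (\int[mu]_x (W x)%:E <= B%:E)%E.
Proof.
move=> mw mW w0 wW wb bB.
exact: le_trans (fatou_ae mw mW w0 wW) (limn_einf_le_cvg wb bB).
Qed.

(** The weighted series of the terms [4 ^+ n * (h n.+1 x - h n x) ^+ 2] has a
finite integral, hence a finite sum at almost every x, where the increments are
then bounded by a geometric sequence of ratio 1/2. *)
Lemma L2_fast_cvg (h : nat -> T -> R) (C : R) :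
  (forall n, measurable_fun setT (h n)) ->
  (forall n, \int[mu]_x ((h n.+1 x - h n x) ^+ 2)%:E <= (C * 16^-1 ^+ n)%:E)%E ->
  exists2 g : T -> R, measurable_fun setT g & {ae mu, forall x, h ^~ x @ \oo --> g x}.
Proof.
move=> mh hC; apply: ae_cvg_measurable => //.
pose w n x : \bar R := (4 ^+ n * (h n.+1 x - h n x) ^+ 2)%:E.
have w0 n x : (0 <= w n x)%E by rewrite lee_fin mulr_ge0 ?sqr_ge0// exprn_ge0.
have mw n : measurable_fun setT (w n).
  apply/measurable_EFinP; apply: measurable_funM => //.
  by apply: measurable_funX; apply: measurable_funB.
have Sfin : (\int[mu]_x (\sum_(n <oo) w n x) < +oo)%E.
  rewrite integral_nneseries//.
  have C0 : 0 <= C.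
    have := hC 0%N; rewrite expr0 mulr1 => h0; rewrite -lee_fin; apply: le_trans h0.
    by apply: integral_ge0 => x _; rewrite lee_fin sqr_ge0.
  have cg : cvgn (series (geometric C 4^-1)).
    by apply: is_cvg_geometric_series; rewrite ger0_norm ?invr_ge0// invf_lt1// ltr1n.
  apply: (@le_lt_trans _ _ (\sum_(n <oo) (geometric C 4^-1 n)%:E)%E); last first.
    rewrite (_ : (fun n => _) = EFin \o series (geometric C 4^-1)); last first.
      by apply/funext => n; rewrite /= /series/= sumEFin.
    by rewrite EFin_lim// ltry.
  apply: lee_nneseries => [n _ _|n _]; first exact: integral_ge0.
  rewrite /w; under eq_integral do rewrite EFinM.
  rewrite ge0_integralZl//; last 2 first.
  - by apply/measurable_EFinP; apply: measurable_funX; apply: measurable_funB.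
  - by move=> x _; rewrite lee_fin sqr_ge0.
  apply: (@le_trans _ _ ((4 ^+ n)%:E * (C * 16^-1 ^+ n)%:E)%E).
    by rewrite lee_wpmul2l ?lee_fin ?exprn_ge0.
  rewrite -EFinM lee_fin /geometric/= mulrCA -exprMn.
  by rewrite (_ : 4 * 16^-1 = 4^-1)//; field.
have : mu.-integrable setT (fun x => \sum_(n <oo) w n x)%E.
  apply/integrableP; split; first exact: ge0_emeasurable_sum.
  by under eq_integral do rewrite gee0_abs ?nneseries_ge0//.
move=> /integrable_ae => /(_ measurableT); apply: filterS => x /(_ I) fx.
pose S := fine (\sum_(n <oo) w n x)%E.
have wS n : `|h n.+1 x - h n x| <= geometric (Num.sqrt S) 2^-1 n.
  have : (w n x <= \sum_(n <oo) w n x)%E.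
    rewrite (@nneseriesD1 _ (w ^~ x) n xpredT)//.
    by rewrite leeDl// nneseries_ge0// => m _ _; exact: w0.
  rewrite -[leRHS]fineK// lee_fin -/S => H.
  have S0 : 0 <= S by apply: le_trans H; rewrite mulr_ge0 ?sqr_ge0// exprn_ge0.
  rewrite -ler_sqr ?nnegrE//; last by rewrite /geometric/= mulr_ge0 ?sqrtr_ge0// exprn_ge0// invr_ge0.
  rewrite real_normK ?num_real// /geometric/= exprMn sqr_sqrtr// -exprM mulnC exprM exprVn.
  by rewrite exprVn ler_pdivlMr ?exprn_gt0 ?exprn_even_gt0// mulrC (_ : 2 ^+ 2 = 4) // -natrX.
have : cvgn (series (telescope (h ^~ x))).
  apply: normed_cvg; apply: series_le_cvg wS _ => //.
  - by move=> n; rewrite /geometric/= mulr_ge0 ?sqrtr_ge0// exprn_ge0// invr_ge0.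
  - by apply: is_cvg_geometric_series; rewrite ger0_norm ?invr_ge0// invf_lt1// ltr1n.
move=> cs; have -> : h ^~ x = (fun n => h 0%N x + series (telescope (h ^~ x)) n).
  by apply/funext => n; rewrite -eq_sum_telescope.
by apply: is_cvgD => //; exact: is_cvg_cst.
Qed.
End Limits.

(** * Lower semicontinuity of the kinetic energy *)

Section RealLine.
Context {R : realType}.
Local Notation mu := (@lebesgue_measure R).
Implicit Types (f g u v h : R -> R) (x y z t d s : R).

Lemma Lfun2_locally_integrable f : f \in Lfun mu 2%:E -> locally_integrable setT f.
Proof.
move=> /Lfun2P[mf fi]; split=> //; first exact: openT.
move=> K _ cK; have mK := compact_measurable cK.
apply: (@le_lt_trans _ _ (\int[mu]_(x in K) ((1 + f x ^+ 2)%:E))%E).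
  apply: ge0_le_integral => //.
  - by apply: measurable_funTS; apply/measurable_EFinP; exact: measurableT_comp.
  - apply: measurable_funTS; apply/measurable_EFinP; apply: measurable_funD => //.
    exact: measurable_funX.
  - move=> x _; rewrite lee_fin -[f x ^+ 2]real_normK ?num_real//.
    have := normr_ge0 (f x); set a := `|f x| => a0.
    have := sqr_ge0 (a - 1); rewrite sqrrB1 => ?; nra.
under eq_integral do rewrite EFinD.
rewrite ge0_integralD//; last 2 first.
- by move=> x _; rewrite lee_fin sqr_ge0.
- by apply: measurable_funTS; apply/measurable_EFinP; exact: measurable_funX.
rewrite lte_add_pinfty//.
  by rewrite integral_cst// mul1e; exact: compact_finite_measure.
apply: le_lt_trans fi; apply: ge0_subset_integral => //.
  by apply/measurable_EFinP; exact: measurable_funX.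
by move=> x _; rewrite lee_fin sqr_ge0.
Qed.

Lemma locally_integrableZ f (c : R) : locally_integrable setT f ->
  locally_integrable setT (fun x => c * f x).
Proof.
move=> [mf oT fi]; split=> //; first exact: measurable_funM.
move=> K KT cK; under eq_integral do rewrite normrM EFinM.
have mK := compact_measurable cK.
rewrite ge0_integralZl//; last first.
  by apply: measurable_funTS; apply/measurable_EFinP; exact: measurableT_comp.
by rewrite lte_mul_pinfty ?lee_fin//; exact: fi.
Qed.

Lemma Lfun2_lin f g (a b : R) : f \in Lfun mu 2%:E -> g \in Lfun mu 2%:E ->
  (fun x => a * f x + b * g x) \in Lfun mu 2%:E.
Proof.
move=> /Lfun2P[mf fi] /Lfun2P[mg gi]; apply/Lfun2P.
have m1 : measurable_fun setT (fun x => a * f x + b * g x).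
  by apply: measurable_funD; apply: measurable_funM.
split=> //.
apply: (@le_lt_trans _ _ (\int[mu]_x ((2 * a ^+ 2)%:E * (f x ^+ 2)%:E +
    (2 * b ^+ 2)%:E * (g x ^+ 2)%:E))%E).
  apply: ge0_le_integral => //.
  - by move=> x _; rewrite lee_fin sqr_ge0.
  - by apply/measurable_EFinP; exact: measurable_funX.
  - by apply: emeasurable_funD; apply: measurable_funeM; apply/measurable_EFinP; exact: measurable_funX.
  - move=> x _; rewrite -!EFinM -EFinD lee_fin.
    have := sqr_ge0 (a * f x - b * g x); rewrite sqrrB sqrrD !exprMn.
    set p := a * f x * _; lra.
rewrite ge0_integralD//; last 4 first.
- by move=> x _; rewrite mule_ge0 ?lee_fin ?sqr_ge0// mulr_ge0 ?sqr_ge0.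
- by apply: measurable_funeM; apply/measurable_EFinP; exact: measurable_funX.
- by move=> x _; rewrite mule_ge0 ?lee_fin ?sqr_ge0// mulr_ge0 ?sqr_ge0.
- by apply: measurable_funeM; apply/measurable_EFinP; exact: measurable_funX.
rewrite !ge0_integralZl//; last 6 first.
- by apply/measurable_EFinP; exact: measurable_funX.
- by move=> x _; rewrite lee_fin sqr_ge0.
- by rewrite lee_fin mulr_ge0 ?sqr_ge0.
- by apply/measurable_EFinP; exact: measurable_funX.
- by move=> x _; rewrite lee_fin sqr_ge0.
- by rewrite lee_fin mulr_ge0 ?sqr_ge0.
by rewrite lte_add_pinfty// lte_mul_pinfty// lee_fin mulr_ge0 ?sqr_ge0.
Qed.

Lemma Lfun2B f g : f \in Lfun mu 2%:E -> g \in Lfun mu 2%:E ->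
  (fun x => f x - g x) \in Lfun mu 2%:E.
Proof.
move=> fL gL; rewrite (_ : (fun x => _) = fun x => 1 * f x + -1 * g x).
  exact: Lfun2_lin.
by apply/funext => x; rewrite mul1r mulN1r.
Qed.

Lemma test_support (phi : R -> R) : test_function phi -> exists a b,
  [/\ a <= b, forall x, ~ `[a, b]%classic x -> phi x = 0 &
    forall x, ~ `[a, b]%classic x -> (phi^`())%classic x = 0].
Proof.
move=> [sphi /compact_bounded[M [Mr HM]]].
pose r := `|M| + 1.
have Hr x : phi x != 0 -> `|x| <= r.
  move=> px; apply: HM; first by rewrite /r (le_lt_trans (ler_norm _))// ltrDl.
  exact: subset_closure.
have H0 x : ~ `[-r, r]%classic x -> phi x = 0.
  move=> xr; apply: contrapT => /eqP /Hr; rewrite ler_norml => h; apply: xr.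
  by rewrite /= in_itv.
exists (- r), r; split=> //.
  by rewrite ge0_cp// /r addr_ge0.
move=> x xr; rewrite derive1E.
rewrite (@near_eq_derive _ _ _ phi (cst 0)) ?derive_cst//.
have oC : open (~` `[-r, r]%classic) by apply: closed_openC; exact: itv_closed.
have := open_nbhs_nbhs (conj oC xr); apply: filterS => t; exact: H0.
Qed.

Lemma weak_derivative_lin u1 g1 u2 g2 (a b : R) :
  weak_derivative u1 g1 -> weak_derivative u2 g2 ->
  weak_derivative (fun x => a * u1 x + b * u2 x) (fun x => a * g1 x + b * g2 x).
Proof.
move=> [lu1 lg1 h1] [lu2 lg2 h2]; split.
- exact: locally_integrableD (locally_integrableZ a lu1) (locally_integrableZ b lu2).
- exact: locally_integrableD (locally_integrableZ a lg1) (locally_integrableZ b lg2).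
move=> phi tphi.
have [p [q [pq phi0 phi0']]] := test_support tphi.
have cphi : continuous phi by apply: smooth_continuous; case: tphi.
have cphi' : continuous (phi^`())%classic.
  by apply: smooth_continuous; apply: smooth_derive; case: tphi.
have lin (w1 w2 k : R -> R) : mu.-integrable setT (fun x => (w1 x * k x)%:E) ->
   mu.-integrable setT (fun x => (w2 x * k x)%:E) ->
   \int[mu]_x ((a * w1 x + b * w2 x) * k x) =
   a * \int[mu]_x (w1 x * k x) + b * \int[mu]_x (w2 x * k x).
  move=> i1 i2; rewrite -!RintegralZl// -RintegralD//; last 2 first.
  - by have := integrableZl measurableT a i1.
  - by have := integrableZl measurableT b i2.
  by apply: eq_Rintegral => x _; ring.
rewrite !lin; [|exact: (locally_integrable_mul _ cphi phi0)..
  |exact: (locally_integrable_mul _ cphi' phi0')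
  |exact: (locally_integrable_mul _ cphi' phi0')].
by rewrite h1// h2//; ring.
Qed.

Local Notation window k := ([set` Interval (BLeft (- (k%:R : R))) (BRight (k%:R : R))]).

(** Closeness is measured in L1 over a window growing with k.  This follows
from bounded pointwise convergence, and it is enough to pass to the limit in
the pairing with a test function.  The sets are convex and decrease with k. *)
Definition approx_derivatives u (k : nat) : set (R -> R) :=
  [set g | g \in Lfun mu 2%:E /\ exists2 v, weak_derivative v g &
    (\int[mu]_(x in window k) `|v x - u x|%:E <= (k.+1%:R^-1)%:E)%E].

Lemma locally_integrable_measurable f (D : set R) :
  locally_integrable setT f -> measurable_fun D f.
Proof. by move=> [mf _ _]; exact: measurable_funTS. Qed.

Lemma measurable_dist f g (D : set R) : measurable_fun D f -> measurable_fun D g ->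
  measurable_fun D (fun x => `|f x - g x|%:E).
Proof.
by move=> mf mg; apply/measurable_EFinP; apply: measurableT_comp => //; apply: measurable_funB.
Qed.

Lemma approx_derivatives_antitone u (k l : nat) : locally_integrable setT u -> (k <= l)%N ->
  approx_derivatives u l `<=` approx_derivatives u k.
Proof.
move=> lu kl g [gL [v wv vu]]; split=> //; exists v => //.
have lv : locally_integrable setT v by case: wv.
apply: (@le_trans _ _ (l.+1%:R^-1)%:E); last first.
  by rewrite lee_fin lef_pV2 ?posrE// ler_nat.
apply: le_trans vu; apply: ge0_subset_integral => //.
  by apply: measurable_dist; exact: locally_integrable_measurable.
by apply: subset_itv; rewrite bnd_simp ?lerN2 ler_nat.
Qed.

Lemma approx_derivatives_midpoint u (k : nat) g1 g2 : locally_integrable setT u ->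
  approx_derivatives u k g1 -> approx_derivatives u k g2 ->
  approx_derivatives u k (fun x => 2^-1 * g1 x + 2^-1 * g2 x).
Proof.
move=> lu [gL1 [v1 wv1 vu1]] [gL2 [v2 wv2 vu2]]; split; first exact: Lfun2_lin.
exists (fun x => 2^-1 * v1 x + 2^-1 * v2 x); first exact: weak_derivative_lin.
have lv1 : locally_integrable setT v1 by case: wv1.
have lv2 : locally_integrable setT v2 by case: wv2.
set J := window k; have mJ : measurable J by exact: measurable_itv.
have m1 := measurable_dist (locally_integrable_measurable (D := J) lv1)
  (locally_integrable_measurable lu).
have m2 := measurable_dist (locally_integrable_measurable (D := J) lv2)
  (locally_integrable_measurable lu).
apply: (@le_trans _ _ (\int[mu]_(x in J) ((2^-1)%:E * `|v1 x - u x|%:E +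
    (2^-1)%:E * `|v2 x - u x|%:E))%E).
  apply: ge0_le_integral => //.
  - apply: measurable_dist; last exact: locally_integrable_measurable.
    by apply: measurable_funD; apply: measurable_funM => //; exact: locally_integrable_measurable.
  - by apply: emeasurable_funD; apply: measurable_funeM.
  - move=> x _; rewrite -!EFinM -EFinD lee_fin.
    rewrite (_ : _ - u x = 2^-1 * (v1 x - u x) + 2^-1 * (v2 x - u x)); last by field.
    by apply: le_trans (ler_normD _ _) _; rewrite !normrM ger0_norm.
rewrite ge0_integralD//; last 2 first.
- exact: measurable_funeM.
- exact: measurable_funeM.
rewrite !ge0_integralZl//.
rewrite (_ : (k.+1%:R^-1)%:E = (2^-1)%:E * (k.+1%:R^-1)%:E + (2^-1)%:E * (k.+1%:R^-1)%:E)%E; last first.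
  by rewrite -!EFinM -EFinD; congr EFin; field; rewrite nat1r.
by apply: leeD; apply: lee_wpmul2l.
Qed.

Definition normsq f : R := \int[mu]_x (f x ^+ 2).

Lemma normsq_ge0 f : 0 <= normsq f.
Proof. by apply: Rintegral_ge0 => x _; exact: sqr_ge0. Qed.

Lemma normsqE f : f \in Lfun mu 2%:E -> (\int[mu]_x (f x ^+ 2)%:E = (normsq f)%:E)%E.
Proof.
move=> /Lfun2P[mf fi]; rewrite fineK//; apply: integrable_fin_num => //.
exact: sqr_integrable.
Qed.

Lemma parallelogram f g : f \in Lfun mu 2%:E -> g \in Lfun mu 2%:E ->
  normsq (fun x => f x - g x) =
  2 * normsq f + 2 * normsq g - 4 * normsq (fun x => 2^-1 * f x + 2^-1 * g x).
Proof.
move=> fL gL; have hL := Lfun2_lin 2^-1 2^-1 fL gL.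
have [mf fi] := (Lfun2P _).1 fL; have [mg gi] := (Lfun2P _).1 gL.
have [mh hi] := (Lfun2P _).1 hL.
have fI := integrableZl measurableT 2 (sqr_integrable mf fi).
have gI := integrableZl measurableT 2 (sqr_integrable mg gi).
have hI := integrableZl measurableT 4 (sqr_integrable mh hi).
rewrite /normsq -!RintegralZl//; try exact: sqr_integrable.
rewrite -RintegralD// -RintegralB//; last exact: (integrableD measurableT fI gI).
by apply: eq_Rintegral => x _; field.
Qed.

Lemma weak_pairing_close u v (psi : R -> R) (a b c : R) (k : nat) :
  locally_integrable setT u -> locally_integrable setT v -> continuous psi ->
  (forall x, ~ `[a, b]%classic x -> psi x = 0) -> (forall x, `|psi x| <= c) ->
  `[a, b]%classic `<=` window k ->
  (\int[mu]_(x in window k) `|v x - u x|%:E <= (k.+1%:R^-1)%:E)%E ->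
  `|\int[mu]_x (v x * psi x) - \int[mu]_x (u x * psi x)| <= c * k.+1%:R^-1.
Proof.
move=> lu lv cpsi psi0 psic abk vu.
have i1 := locally_integrable_mul lv cpsi psi0.
have i2 := locally_integrable_mul lu cpsi psi0.
have i3 := integrableB measurableT i1 i2.
have c0 : 0 <= c by apply: le_trans (psic 0).
rewrite -RintegralB//; apply: (le_trans (le_normr_Rintegral _ i3)) => //.
rewrite /Rintegral -lee_fin fineK; last first.
  by apply: integrable_fin_num => //; exact: integrable_norm i3.
rewrite EFinM; apply: (@le_trans _ _ (c%:E * \int[mu]_(x in window k) `|v x - u x|%:E)%E); last first.
  by rewrite lee_wpmul2l.
have mk : measurable_fun (window k) (fun x => `|v x - u x|%:E).
  by apply: measurable_dist; exact: locally_integrable_measurable.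
rewrite -ge0_integralZl//= [leRHS]integral_mkcond; apply: ge0_le_integral => //.
- by have /integrableP[+ _] := integrable_norm i3.
- exact: (measurable_restrictT _ (measurable_itv _)).1 (measurable_funeM c%:E mk).
move=> x _; rewrite /= patchE; case: ifPn => [_|].
  by rewrite -EFinM lee_fin -mulrBl normrM mulrC ler_wpM2r.
rewrite notin_setE => xk; rewrite psi0 ?mulr0 ?subrr ?normr0//.
by move=> /abk.
Qed.

Lemma window_exhaust (a b : R) : \forall k \near \oo, `[a, b]%classic `<=` window k.
Proof.
near=> k; apply: subset_itv; rewrite bnd_simp.
- rewrite lerNl; near: k; exact: nbhs_infty_ger.
- near: k; exact: nbhs_infty_ger.
Unshelve. all: by end_near. Qed.

Lemma cvg_exp4_exp16 (C : R) : 4 ^+ n * (C * 16^-1 ^+ n) @[n --> \oo] --> (0 : R).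
Proof.
rewrite (_ : (fun n => _) = geometric C 4^-1); last first.
  by apply/funext => n; rewrite /geometric/= mulrCA -exprMn (_ : 4 * 16^-1 = 4^-1)//; field.
by apply: cvg_geometric; rewrite ger0_norm ?invr_ge0// invf_lt1// ltr1n.
Qed.

Lemma cvg_exp4V : ((4 : R) ^+ n)^-1 @[n --> \oo] --> (0 : R).
Proof.
rewrite (_ : (fun n => _) = geometric 1 4^-1); last first.
  by apply/funext => n; rewrite /geometric/= mul1r exprVn.
by apply: cvg_geometric; rewrite ger0_norm ?invr_ge0// invf_lt1// ltr1n.
Qed.

(** In [l2_pairing_le] the weight [4 ^+ j] turns an error of order [16^-1 ^+ j]
on the squared norms into one of order [4^-1 ^+ j] on the pairings. *)
Lemma weak_derivative_closed u h (hj : nat -> R -> R) (C : R) :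
  locally_integrable setT u -> h \in Lfun mu 2%:E ->
  (forall j, approx_derivatives u j (hj j)) ->
  (forall j, normsq (fun x => hj j x - h x) <= C * 16^-1 ^+ j) ->
  weak_derivative u h.
Proof.
move=> lu hL ap hC; have lh := Lfun2_locally_integrable hL.
split=> // phi tphi.
have [a [b [ab phi0 phi0']]] := test_support tphi.
have sphi : smooth phi by case: tphi.
have cphi := smooth_continuous sphi.
have cphi' := smooth_continuous (smooth_derive sphi).
have [c [cr Hc]] := supp_bounded cphi phi0.
have [c' [cr' Hc']] := supp_bounded cphi' phi0'.
have {}Hc x : `|phi x| <= `|c| + 1.
  by apply: Hc => //; rewrite (le_lt_trans (ler_norm _))// ltrDl.
have {}Hc' x : `|(phi^`())%classic x| <= `|c'| + 1.
  by apply: Hc' => //; rewrite (le_lt_trans (ler_norm _))// ltrDl.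
set I := \int[mu]_x _; set I' := \int[mu]_x _.
pose e (n : nat) : R := (`|c'| + 1) * n.+1%:R^-1 +
  2^-1 * (4 ^+ n * (C * 16^-1 ^+ n) + (4 ^+ n)^-1 * ((`|c| + 1) ^+ 2 * (b - a))).
have e0 : e @ \oo --> (0 : R).
  rewrite [X in _ --> X](_ : 0 = (`|c'| + 1) * 0 + 2^-1 * (0 + 0 * ((`|c| + 1) ^+ 2 * (b - a)))); last by ring.
  apply: cvgD.
    by apply: cvgM; [exact: cvg_cst|exact: cvg_harmonic].
  apply: cvgM; first exact: cvg_cst.
  apply: cvgD; first exact: cvg_exp4_exp16.
  by apply: cvgM; [exact: cvg_exp4V|exact: cvg_cst].
apply/eqP; rewrite -subr_eq0 -normr_le0; apply/eqP; move: e0.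
suff H : \forall n \near \oo, `|I - - I'| <= e n.
  move=> e0; apply/eqP; rewrite normr_le0 -normr_le0; exact: (cvgr_to_ge e0 H).
near=> n.
have abn : `[a, b]%classic `<=` window n by near: n; exact: window_exhaust.
have [hjL [v [lv lhj hv] vu]] := ap n.
have d1 := weak_pairing_close lu lv cphi' phi0' Hc' abn vu.
have p4 : 0 < (4 : R) ^+ n by rewrite exprn_gt0.
have dL := Lfun2B hjL hL.
have d2 := l2_pairing_le (Lfun2_locally_integrable dL) dL cphi ab p4 phi0 Hc.
have d3 : \int[mu]_x ((hj n x - h x) * phi x) =
    \int[mu]_x (hj n x * phi x) - \int[mu]_x (h x * phi x).
  rewrite -RintegralB//; [|exact: locally_integrable_mul cphi phi0..].
  by apply: eq_Rintegral => x _; ring.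
move: d1 d2; rewrite d3 -/I -/I' hv//.
set P := \int[mu]_x (hj n x * phi x) => d1 d2.
have -> : I - - I' = - (- P - I) - (P - I') by ring.
apply: le_trans (ler_normB _ _) _; rewrite normrN /e; apply: lerD d1 _.
by apply: le_trans d2 _; rewrite ler_pM2l// lerD2r ler_pM2l//; exact: hC.
Unshelve. all: by end_near. Qed.

(** The infima [a k] of the squared norm over the decreasing convex sets
[approx_derivatives u k] increase to a limit [A <= B].  Choose [h j] almost
minimal in a set of large index.  The midpoint of two such functions lies in
one of the sets, so its squared norm cannot be much smaller than A, and the
parallelogram identity makes the sequence h Cauchy.  Its limit is a weak
derivative of u of squared norm at most A. *)
Lemma kinetic_lsc u (v g : nat -> R -> R) (b : nat -> R) (B : R) :
  locally_integrable setT u ->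
  (forall n, weak_derivative (v n) (g n)) -> (forall n, g n \in Lfun mu 2%:E) ->
  (forall n, normsq (g n) <= b n) -> b @ \oo --> B ->
  (forall k, (fun n => \int[mu]_(x in window k) `|v n x - u x|%:E)%E @ \oo --> 0%E) ->
  exists h, [/\ weak_derivative u h, h \in Lfun mu 2%:E & normsq h <= B].
Proof.
move=> lu wd gL gb bB vu.
pose S k := [set normsq h | h in approx_derivatives u k].
pose a k := inf (S k).
have Slb k : has_lbound (S k) by exists 0 => _ [h _ <-]; exact: normsq_ge0.
have near_ap k : \forall n \near \oo, approx_derivatives u k (g n).
  have [fin cv] := (fine_cvgP _ _).1 (vu k).
  near=> n; split=> //; exists (v n) => //.
  have finn : (\int[mu]_(x in window k) `|v n x - u x|%:E)%E \is a fin_num by near: n.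
  rewrite -[leLHS]fineK// lee_fin.
  by near: n; apply: cvgr_le cv _ _; rewrite invr_gt0.
have aB k : a k <= B.
  apply: (cvgr_to_ge bB); near=> n; apply: le_trans (gb n).
  by apply: ge_inf => //; exists (g n) => //; near: n; exact: near_ap.
have S0 k : S k !=set0.
  by have [n _ Hn] := near_ap k; exists (normsq (g n)), (g n) => //; exact: (Hn n (leqnn n)).
have amono k l : (k <= l)%N -> a k <= a l.
  move=> kl; apply: lb_le_inf => // _ [h hl <-].
  by apply: ge_inf => //; exists h => //; exact: approx_derivatives_antitone hl.
pose A := sup (range a).
have Aub : has_sup (range a).
  by split; [exists (a 0%N), 0%N|exists B => _ [k _ <-]].
have aA k : a k <= A by apply: sup_upper_bound => //; exists k.
have AB : A <= B by apply: sup_le_ub => [|_ [k _ <-]//]; exists (a 0%N), 0%N.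
have /choice[p Hp] : forall j, exists p : nat * (R -> R),
    [/\ (j <= p.1)%N, approx_derivatives u p.1 p.2, normsq p.2 <= A + 16^-1 ^+ j &
        A - 16^-1 ^+ j <= a p.1].
  move=> j; have e0 : 0 < (16^-1 : R) ^+ j by rewrite exprn_gt0// invr_gt0.
  have [_ [k _ <-] Hk] := sup_adherent e0 Aub.
  (* The index is at least j, so that [h j] is also close to u at scale j. *)
  pose l := maxn j k.
  have [_ [h hl <-] Hh] := inf_adherent e0 (conj (S0 l) (Slb l)).
  exists (l, h); split=> //=.
  - exact: leq_maxl.
  - by apply/ltW/(lt_le_trans Hh); rewrite lerD2r; exact: aA.
  - by apply: (le_trans (ltW Hk)); apply: amono; exact: leq_maxr.
pose h j := (p j).2.
have hL j : h j \in Lfun mu 2%:E by have [_ [] ] := Hp j.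
have hcauchy i j : (i <= j)%N ->
    normsq (fun x => h j x - h i x) <= 8 * 16^-1 ^+ i.
  move=> ij; rewrite parallelogram//.
  have [_ ai hi li] := Hp i; have [_ aj hj lj] := Hp j.
  have ji : (16^-1 : R) ^+ j <= 16^-1 ^+ i.
    by apply: ler_wiXn2l => //; rewrite ?invr_ge0 ?invf_le1 ?ler1n.
  pose m := minn (p i).1 (p j).1.
  have am : A - 16^-1 ^+ i <= a m.
    rewrite /m; case: leqP => _; first exact: li.
    by apply: le_trans lj; rewrite lerD2l lerN2.
  have : a m <= normsq (fun x => 2^-1 * h j x + 2^-1 * h i x).
    apply: ge_inf => //; eexists; last reflexivity.
    apply: approx_derivatives_midpoint => //; apply: approx_derivatives_antitone.
    1,4: exact: lu.
    - exact: geq_minr.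
    - exact: aj.
    - exact: geq_minl.
    - exact: ai.
  move=> mid; have := le_trans am mid.
  rewrite -/(h i) in hi; rewrite -/(h j) in hj.
  set M := normsq (fun x => _ + _).
  by move: hi hj ji; set t := 16^-1 ^+ i; set t' := 16^-1 ^+ j; lra.
have [H mH Hcv] : exists2 H : R -> R, measurable_fun setT H &
    {ae mu, forall x, h ^~ x @ \oo --> H x}.
  apply: (@L2_fast_cvg _ _ _ mu h 8) => n; first by have /Lfun2P[] := hL n.
  have := hcauchy n n.+1 (leqnSn n).
  by rewrite -lee_fin -normsqE; last exact: Lfun2B.
have mh j : measurable_fun setT (h j) by have /Lfun2P[] := hL j.
have HA : (\int[mu]_x (H x ^+ 2)%:E <= A%:E)%E.
  apply: (@fatou_cvg _ _ _ mu (fun j x => h j x ^+ 2) _ (fun j => A + 16^-1 ^+ j)).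
  - by move=> n; exact: (measurable_funX 2 (mh n)).
  - exact: measurable_funX.
  - by move=> *; exact: sqr_ge0.
  - apply: filterS Hcv; first exact: (ae_filter_ringOfSetsType mu).
    by move=> x Hx; exact: cvg_sqr.
  - by move=> n; rewrite normsqE// lee_fin; have [] := Hp n.
  - rewrite -[X in _ --> X]addr0; apply: cvgD; first exact: cvg_cst.
    by apply: cvg_expr; rewrite ger0_norm ?invr_ge0// invf_lt1// ltr1n.
have HL : H \in Lfun mu 2%:E by apply/Lfun2P; split=> //; exact: le_lt_trans HA (ltry _).
exists H; split=> //; last first.
  by rewrite -lee_fin -normsqE//; apply: le_trans HA _; rewrite lee_fin.
apply: (@weak_derivative_closed _ _ h 8) => // j.
  by have [jp ap _ _] := Hp j; exact: approx_derivatives_antitone ap.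
rewrite -lee_fin -normsqE; last exact: Lfun2B.
apply: (@fatou_cvg _ _ _ mu (fun n x => (h j x - h (n + j)%N x) ^+ 2) _ (fun=> 8 * 16^-1 ^+ j)).
- by move=> n; exact: (measurable_funX 2 (measurable_funB (mh j) (mh (n + j)%N))).
- exact: (measurable_funX 2 (measurable_funB (mh j) mH)).
- by move=> *; exact: sqr_ge0.
- apply: filterS Hcv; first exact: (ae_filter_ringOfSetsType mu).
  move=> x Hx.
  have Hx' : h (n + j)%N x @[n --> \oo] --> H x by have := Hx; rewrite -(cvg_shiftn j).
  have D : h j x - h (n + j)%N x @[n --> \oo] --> h j x - H x.
    by apply: cvgB => //; exact: cvg_cst.
  exact: cvg_sqr.
- move=> n; rewrite normsqE; last exact: Lfun2B.
  rewrite lee_fin; apply: le_trans (hcauchy j (n + j)%N (leq_addl _ _)).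
  rewrite le_eqVlt; apply/orP; left; apply/eqP; apply: eq_Rintegral => x _; ring.
- exact: cvg_cst.
Unshelve. all: by end_near. Qed.

(** * Compactness of minimising sequences *)

(** A bounded sequence has a cluster point along G; an ultrafilter converges to
its cluster points. *)
Lemma ultra_bounded_cvg (G : set_system nat) (w : nat -> R) (M : R) : UltraFilter G ->
  (forall n, `|w n| <= M) -> exists l : R, w n @[n --> G] --> l.
Proof.
move=> GU wM.
have [|l [_ cl]] := @segment_compact R (- M) M (w @ G) _.
  apply: (@filterE _ G) => n.
  by rewrite /= in_itv/= -ler_norml.
exists l; apply/cvgrPdist_lt => e e0.
have [//|GC] := in_ultra_setVsetC [set n | `|l - w n| < e] GU.
have [|y [/= y1 y2]] := cl [set y | ~ (`|l - y| < e)] (ball l e) _ (nbhsx_ballx l e e0).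
  exact: GC.
by exfalso; apply: y1.
Qed.

(** An ultrafilter replaces the diagonal extraction: it provides limits at all
points of a countable dense subset of A at once, and [f k] is an index at which
the first k of these limits are attained up to [k.+1%:R^-1].  The Hölder bound
propagates convergence to all of A.  The numerical sequence t is carried along
so that one extraction serves both purposes. *)
Lemma holder_subsequence (A : set R) (v : nat -> R -> R) (t : nat -> R) (M L K : R) :
  (forall x (e : R), 0 < e -> exists2 y, A y & `|x - y| < e) ->
  (forall n x, A x -> `|v n x| <= M) ->
  0 <= L -> (forall n x y, A x -> A y -> `|v n x - v n y| <= L * Num.sqrt `|x - y|) ->
  (forall n, `|t n| <= K) ->
  exists (f : nat -> nat) (T : R), [/\ forall k, (k <= f k)%N,
    t (f k) @[k --> \oo] --> T & forall x, A x -> cvgn (fun k => v (f k) x)].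
Proof.
move=> dA vM L0 vL tK.
have [G [GU oG]] := ultraFilterLemma (_ : ProperFilter \oo).
have /choice[d Hd] : forall p : rat * nat, exists y, A y /\ `|ratr p.1 - y| < p.2.+1%:R^-1.
  move=> p; have [|y Ay py] := dA (ratr p.1) p.2.+1%:R^-1; first by rewrite invr_gt0.
  by exists y.
have /choice[l Hl] : forall p, exists l : R, v n (d p) @[n --> G] --> l.
  move=> p; apply: (@ultra_bounded_cvg _ _ M) => n; apply: vM; exact: (Hd p).1.
have [T HT] := ultra_bounded_cvg GU tK.
have /choice[f Hf] : forall k, exists n, [/\ (k <= n)%N, `|t n - T| < k.+1%:R^-1 &
    forall i : 'I_k, forall p, unpickle i = Some p -> `|v n (d p) - l p| < k.+1%:R^-1].
  move=> k.
  have e0 : 0 < (k.+1%:R^-1 : R) by rewrite invr_gt0.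
  suff : G [set n | [/\ (k <= n)%N, `|t n - T| < k.+1%:R^-1 &
    forall i : 'I_k, forall p, unpickle i = Some p -> `|v n (d p) - l p| < k.+1%:R^-1]].
    by move/filter_ex.
  have h1 : G [set n | (k <= n)%N] by apply: oG; exact: nbhs_infty_ge.
  have h2 : G [set n | `|t n - T| < k.+1%:R^-1].
    by have /cvgrPdist_lt/(_ _ e0) := HT; apply: filterS => n; rewrite distrC.
  have h3 : G [set n | forall i : 'I_k, forall p,
      unpickle i = Some p -> `|v n (d p) - l p| < k.+1%:R^-1].
    apply: filter_forall => i.
    case: (unpickle i) => [p|]; last by apply: filterE => n p.
    have /cvgrPdist_lt/(_ _ e0) := Hl p; apply: filterS => n; rewrite distrC => h q [<-]; exact: h.
  apply: (@filterS _ G _ _ _ _ (filterI h1 (filterI h2 h3))) => n [? [? ?]]; split => //.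
exists f, T; split.
- by move=> k; have [] := Hf k.
- apply/cvgrPdist_lt => e e0; near=> k; rewrite distrC.
  have [_ h _] := Hf k; apply: lt_trans h _; near: k.
  by have := near_infty_natSinv_lt (PosNum e0).
move=> x Ax; apply/cauchy_cvgP; apply: cauchy_exP => e e0.
(* At distance less than [2 * r] the Hölder bound is at most [e / 2]; dividing
   by [L + 1] covers the case [L = 0]. *)
pose r := (e / 2 / (L + 1)) ^+ 2 / 2.
have r0 : 0 < r by rewrite divr_gt0// exprn_gt0// !divr_gt0// ltr_wpDl.
have [q xq] : exists q : rat, `|x - ratr q| < r.
  have [|q] := @rat_in_itvoo R (x - r) (x + r); first lra.
  by rewrite in_itv/= => /andP[h1 h2]; exists q; rewrite ltr_distlC; apply/andP; split; lra.
have [m Hm] : exists m : nat, (m.+1%:R^-1 : R) < r.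
  have /(_ (PosNum r0)) [m _ h] := @near_infty_natSinv_lt R.
  by exists m; exact: (h m (leqnn m)).
pose p := (q, m).
have [Ad xd] := Hd p.
have xdp : `|x - d p| < (e / 2 / (L + 1)) ^+ 2.
  rewrite (_ : x - d p = (x - ratr q) + (ratr q - d p)); last by ring.
  apply: le_lt_trans (ler_normD _ _) _.
  rewrite (_ : _ ^+ 2 = r + r); last by rewrite /r; field; rewrite gt_eqF// ltr_wpDl.
  by apply: ltrD => //; exact: lt_trans xd Hm.
have Ld : L * Num.sqrt `|x - d p| <= e / 2.
  have s0 : 0 <= e / 2 / (L + 1) by rewrite !divr_ge0// ?addr_ge0// ltW.
  have : Num.sqrt `|x - d p| <= e / 2 / (L + 1).
    by rewrite -ler_sqr ?nnegrE ?sqrtr_ge0// sqr_sqrtr//; exact: ltW.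
  rewrite ler_pdivlMr; last by rewrite ltr_wpDl.
  have := sqrtr_ge0 `|x - d p|; set S := Num.sqrt _; nra.
have e2 : 0 < e / 2 by rewrite divr_gt0.
exists (l p); suff : \forall k \near \oo, ball (l p) e (v (f k) x) by [].
near=> k.
rewrite /ball/= (_ : l p - v (f k) x = (l p - v (f k) (d p)) + (v (f k) (d p) - v (f k) x)); last by ring.
rewrite (splitr e); apply: le_lt_trans (ler_normD _ _) _.
apply: ltr_leD; last by rewrite distrC; apply: le_trans Ld; exact: vL.
have [_ _ h] := Hf k.
have pk : (pickle p < k)%N by near: k; exact: nbhs_infty_gt.
rewrite distrC; apply: lt_trans (h (Ordinal pk) p _) _; first exact: pickleK.
near: k; exact: (near_infty_natSinv_lt (PosNum e2)).
Unshelve. all: by end_near. Qed.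

(** A ball has positive measure, hence is not contained in a null set. *)
Lemma ae_dense (A : set R) : {ae mu, forall x, A x} ->
  forall x (e : R), 0 < e -> exists2 y : R, A y & `|x - y| < e.
Proof.
move=> [N [mN N0 AN]] x e e0; apply: contrapT => H.
have bN : ball x e `<=` N.
  by move=> y xy; apply: AN => /= Ay; apply: H; exists y.
have : (mu (ball x e) <= mu N)%E by apply: le_measure => //; rewrite inE//; exact: measurable_ball.
rewrite N0 (lebesgue_measure_ball _ (ltW e0)) lee_fin; lra.
Qed.

(** The mean of [v ^+ 2] over [[x, x + 1]] is at most 1, while v varies by at
most L there. *)
Lemma holder_sup_bound (A : set R) (v : R -> R) (L : R) : {ae mu, forall x, A x} ->
  measurable_fun setT v -> (\int[mu]_x (v x ^+ 2)%:E <= 1)%E ->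
  0 <= L -> (forall x y, A x -> A y -> `|v x - v y| <= L * Num.sqrt `|x - y|) ->
  forall x, A x -> `|v x| <= 2 + 2 * L.
Proof.
move=> aA mv v1 L0 vL x Ax.
pose D := `[x, x + 1]%classic.
have mD : measurable D by exact: measurable_itv.
have muD : mu D = 1%E.
  by rewrite /D lebesgue_measure_itv/= lte_fin ltrDl ltr01 -EFinD addrAC subrr add0r.
have mv2 (E : set R) : measurable_fun E (fun y => (v y ^+ 2)%:E).
  by apply: measurable_funTS; apply/measurable_EFinP; exact: measurable_funX.
have : (\int[mu]_(y in D) (v x ^+ 2)%:E <=
        \int[mu]_(y in D) (2%:E * (v y ^+ 2)%:E + (2 * L ^+ 2)%:E))%E.
  apply: ae_ge0_le_integral => //.
  - by move=> y _; rewrite lee_fin sqr_ge0.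
  - by move=> y _; rewrite -EFinM -EFinD lee_fin addr_ge0// mulr_ge0// sqr_ge0.
  - by apply: emeasurable_funD => //; exact: (measurable_funeM 2%:E (mv2 D)).
  - apply: filterS aA; first exact: (ae_filter_ringOfSetsType mu).
    move=> y Ay; rewrite /D/= in_itv/= => /andP[y1 y2].
    rewrite -EFinM -EFinD lee_fin.
    have h : `|v x - v y| <= L.
      apply: le_trans (vL x y Ax Ay) _; rewrite ler_piMr// -sqrtr1 ler_wsqrtr//.
      by rewrite distrC ger0_norm; lra.
    have : (v x - v y) ^+ 2 <= L ^+ 2 by rewrite -[leLHS]real_normK ?num_real// ler_sqr ?nnegrE.
    have := sqr_ge0 (v x - 2 * v y); nra.
rewrite integral_cst//= muD mule1 ge0_integralD//; last 3 first.
- by move=> y _; rewrite -EFinM lee_fin mulr_ge0// sqr_ge0.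
- exact: (measurable_funeM 2%:E (mv2 D)).
- by move=> y _; rewrite lee_fin mulr_ge0// sqr_ge0.
rewrite ge0_integralZl//; [|exact: mv2|by move=> y _; rewrite lee_fin sqr_ge0].
rewrite integral_cst//= muD mule1 => h.
have : ((v x ^+ 2)%:E <= 2%:E * 1 + (2 * L ^+ 2)%:E)%E.
  apply: le_trans h _; rewrite leeD2r// lee_wpmul2l// (le_trans _ v1)//.
  apply: ge0_subset_integral => //; first exact: mv2.
  by move=> y _; rewrite lee_fin sqr_ge0.
rewrite mule1 -EFinD lee_fin => {}h.
rewrite -ler_sqr ?nnegrE//; last by rewrite addr_ge0// mulr_ge0.
rewrite real_normK ?num_real//; nra.
Qed.

(** The Hölder estimate is uniform in n on the set of the points that are
Lebesgue points of all the [v n], which has full measure. *)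
Lemma weak_compactness (v g : nat -> R -> R) (K : R) :
  (forall n, weak_derivative (v n) (g n)) -> (forall n, g n \in Lfun mu 2%:E) ->
  (forall n, normsq (g n) <= K) ->
  (forall n, \int[mu]_x (v n x ^+ 2)%:E <= 1)%E ->
  exists (f : nat -> nat) (u : R -> R) (T M : R),
    [/\ forall k, (k <= f k)%N, normsq (g (f k)) @[k --> \oo] --> T,
      measurable_fun setT u, {ae mu, forall x, v (f k) x @[k --> \oo] --> u x} &
      {ae mu, forall x, forall n, `|v n x| <= M}].
Proof.
move=> wd gL gK v1.
have lv n : locally_integrable setT (v n) by case: (wd n).
have mv n : measurable_fun setT (v n) by case: (lv n).
pose A := [set x | forall n, lebesgue_pt (v n) x].
have aA : {ae mu, forall x, A x}.
  by apply: ae_foralln => n; exact: lebesgue_differentiation.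
have K0 : 0 <= K by apply: le_trans (gK 0%N); exact: normsq_ge0.
pose L := K + 1.
have L0 : 0 <= L by rewrite addr_ge0.
have vL n x y : A x -> A y -> `|v n x - v n y| <= L * Num.sqrt `|x - y|.
  move=> Ax Ay; apply: le_trans (weak_derivative_holder (wd n) (gL n) (Ax n) (Ay n)) _.
  by rewrite ler_wpM2r ?sqrtr_ge0// lerD2r; exact: gK.
have vM n x : A x -> `|v n x| <= 2 + 2 * L.
  by apply: (@holder_sup_bound A) => //; exact: vL.
have gK' n : `|normsq (g n)| <= K by rewrite ger0_norm// normsq_ge0.
have [f [T [fk gT cv]]] := holder_subsequence (ae_dense aA) vM L0 vL gK'.
have [u mu_ vu] : exists2 u : R -> R, measurable_fun setT u &
    {ae mu, forall x, v (f k) x @[k --> \oo] --> u x}.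
  apply: (@ae_cvg_measurable _ _ _ mu (fun k => v (f k))); first by move=> n; exact: mv.
  by apply: filterS aA; [exact: (ae_filter_ringOfSetsType mu)|exact: cv].
exists f, u, T, (2 + 2 * L); split => //.
apply: filterS aA; first exact: (ae_filter_ringOfSetsType mu).
by move=> x Ax n; exact: vM.
Qed.

Lemma bounded_cvg_window (w : nat -> R -> R) (u : R -> R) (M : R) (k : nat) :
  (forall n, measurable_fun setT (w n)) -> measurable_fun setT u ->
  {ae mu, forall x, w n x @[n --> \oo] --> u x} ->
  {ae mu, forall x, forall n, `|w n x| <= M} ->
  (fun n => \int[mu]_(x in window k) `|w n x - u x|%:E)%E @ \oo --> 0%E /\
  (\int[mu]_(x in window k) (w n x)%:E)%E @[n --> \oo] -->
    (\int[mu]_(x in window k) (u x)%:E)%E.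
Proof.
move=> mw mu_ wu wM.
have mk : measurable (window k) by exact: measurable_itv.
have [] := @dominated_convergence _ _ _ mu (window k) mk
  (fun n x => (w n x)%:E) (fun x => (u x)%:E) (cst M%:E).
- move=> n; apply: measurable_funTS.
  apply/measurable_EFinP.
  exact: mw.
- by apply: measurable_funTS; exact/measurable_EFinP.
- apply: filterS wu; first exact: (ae_filter_ringOfSetsType mu).
  by move=> x wx _; apply: cvg_EFin; [exact: nearW|exact: wx].
- apply: (@measurable_bounded_integrable _ _ _ mu (cst M)) => //.
    by apply: compact_finite_measure; exact: segment_compact.
  by exists `|M|; split=> // t Mt x _; exact: ltW.
- apply: filterS wM; first exact: (ae_filter_ringOfSetsType mu).
  by move=> x wx n _; rewrite lee_fin; exact: wx.
by move=> _ h1 h2; split.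
Qed.

(** No mass is created, by Fatou's lemma, and none is lost: by Markov's
inequality the mass outside the window of size k is at most [C / k], and inside
a window the functions converge boundedly. *)
Lemma limit_mass (w : nat -> R -> R) (u : R -> R) (M C : R) :
  (forall n, measurable_fun setT (w n)) -> measurable_fun setT u ->
  {ae mu, forall x, w n x @[n --> \oo] --> u x} ->
  {ae mu, forall x, forall n, `|w n x| <= M} ->
  (forall n, \int[mu]_x (w n x ^+ 2)%:E = 1)%E ->
  (forall n, \int[mu]_x (`|x| * w n x ^+ 2)%:E <= C%:E)%E ->
  (\int[mu]_x (u x ^+ 2)%:E = 1)%E.
Proof.
move=> mw mu_ wu wM w1 wC.
have mw2 n : measurable_fun setT (fun x => w n x ^+ 2) by exact: measurable_funX.
have mu2 : measurable_fun setT (fun x => u x ^+ 2) by exact: measurable_funX.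
have wu2 : {ae mu, forall x, w n x ^+ 2 @[n --> \oo] --> u x ^+ 2}.
  apply: filterS wu; first exact: (ae_filter_ringOfSetsType mu).
  by move=> x; exact: cvg_sqr.
have wM2 : {ae mu, forall x, forall n, `|w n x ^+ 2| <= M ^+ 2}.
  apply: filterS wM; first exact: (ae_filter_ringOfSetsType mu).
  move=> x wx n; rewrite normrX ler_sqr ?nnegrE//.
  by apply: le_trans (wx 0%N).
apply/eqP; rewrite eq_le; apply/andP; split.
  apply: (@fatou_cvg _ _ _ mu (fun n x => w n x ^+ 2) _ (fun=> 1)) => //.
  - by move=> *; exact: sqr_ge0.
  - by move=> n; rewrite w1.
  - exact: cvg_cst.
have C0 : 0 <= C.
  rewrite -lee_fin; apply: le_trans (wC 0%N).
  by apply: integral_ge0 => x _; rewrite lee_fin mulr_ge0// sqr_ge0.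
have mabs : measurable_fun setT (fun x : R => `|x|) by exact: measurableT_comp.
have tail k n : (1 <= \int[mu]_(x in window k.+1) (w n x ^+ 2)%:E + (C * k.+1%:R^-1)%:E)%E.
  have m1 : measurable_fun setT ((fun x => (w n x ^+ 2)%:E) \_ (window k.+1)).
    have mk : measurable_fun (window k.+1) (fun x => (w n x ^+ 2)%:E).
      by apply: measurable_funTS; apply/measurable_EFinP; exact: mw2.
    exact: (measurable_restrictT _ (measurable_itv _)).1 mk.
  have m2 : measurable_fun setT (fun x => (`|x| * w n x ^+ 2)%:E).
    by apply/measurable_EFinP; apply: measurable_funM.
  rewrite -(w1 n) [X in (_ <= X + _)%E]integral_mkcond.
  apply: (@le_trans _ _ (\int[mu]_x (((fun x => (w n x ^+ 2)%:E) \_ (window k.+1)) x +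
     (k.+1%:R^-1)%:E * (`|x| * w n x ^+ 2)%:E))%E).
    apply: ge0_le_integral => //.
    - by move=> x _; rewrite lee_fin sqr_ge0.
    - by apply/measurable_EFinP; exact: mw2.
    - exact: (emeasurable_funD m1 (measurable_funeM _ m2)).
    - move=> x _; rewrite patchE; case: ifPn => [_|].
        by rewrite -EFinM -EFinD lee_fin lerDl mulr_ge0 ?invr_ge0// mulr_ge0 ?sqr_ge0.
      rewrite notin_setE/= in_itv/= => /negP; rewrite -ler_norml -ltNge => kx.
      rewrite add0e -EFinM lee_fin mulrA ler_peMl ?sqr_ge0//.
      by rewrite ler_pdivlMl// mulr1 ltW.
  rewrite ge0_integralD//; last 3 first.
  - by move=> x _; apply: erestrict_ge0 => y _; rewrite lee_fin sqr_ge0.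
  - by move=> x _; rewrite -EFinM lee_fin mulr_ge0 ?invr_ge0// mulr_ge0 ?sqr_ge0.
  - exact: (measurable_funeM _ m2).
  rewrite leeD2l// ge0_integralZl//; last by move=> x _; rewrite lee_fin mulr_ge0// sqr_ge0.
  by rewrite mulrC EFinM lee_wpmul2l.
have lim k : (1 <= \int[mu]_x (u x ^+ 2)%:E + (C * k.+1%:R^-1)%:E)%E.
  have [_ cv] := bounded_cvg_window k.+1 mw2 mu2 wu2 wM2.
  have cv' : (\int[mu]_(x in window k.+1) (w n x ^+ 2)%:E + (C * k.+1%:R^-1)%:E)%E @[n --> \oo]
      --> (\int[mu]_(x in window k.+1) (u x ^+ 2)%:E + (C * k.+1%:R^-1)%:E)%E.
    by apply: cvgeD => //; [exact: fin_num_adde_defl|exact: cvg_cst].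
  apply: (@le_trans _ _ (\int[mu]_(x in window k.+1) (u x ^+ 2)%:E + (C * k.+1%:R^-1)%:E)%E).
    by apply: (cvge_to_ge cv'); apply: nearW => n; exact: tail.
  rewrite leeD2r//; apply: ge0_subset_integral => //; first exact/measurable_EFinP.
  by move=> x _; rewrite lee_fin sqr_ge0.
have cv : (\int[mu]_x (u x ^+ 2)%:E + (C * k.+1%:R^-1)%:E)%E @[k --> \oo] -->
    (\int[mu]_x (u x ^+ 2)%:E + (C * 0)%:E)%E.
  apply: cvgeD; [by rewrite mulr0 fin_num_adde_defl|exact: cvg_cst|].
  apply: cvg_EFin; first exact: nearW.
  by apply: cvgM; [exact: cvg_cst|exact: cvg_harmonic].
rewrite -[leRHS]adde0 -[X in (_ + X)%E]/(0%:E) -(mulr0 C).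
by apply: (cvge_to_ge cv); apply: nearW => k; exact: lim.
Qed.

(** * The potential energy *)

Definition moment u : R := \int[mu]_x (`|x| * u x ^+ 2).

Definition coulomb u : R :=
  \int[mu]_x (\int[mu]_y (`|x - y| * u x ^+ 2 * u y ^+ 2)).

(** The integrand of the potential energy of a density of mass 1, the term
[z * |x|] being symmetrised in x and y. *)
Definition pair_kernel z x y : R := z * (2^-1 * (`|x| + `|y|)) - 2^-1 * `|x - y|.

Definition unit_mass_moment u := [/\ measurable_fun setT u,
  (\int[mu]_x (u x ^+ 2)%:E = 1)%E & (\int[mu]_x (`|x| * u x ^+ 2)%:E < +oo)%E].

Lemma pair_kernel_ge0 z x y : 1 <= z -> 0 <= pair_kernel z x y.
Proof.
move=> z1; have := ler_normB x y; have := normr_ge0 x; have := normr_ge0 y.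
rewrite /pair_kernel; set a := `|x|; set b := `|y|; set c := `|x - y|; nra.
Qed.

Section Identity.
Variables (u : R -> R) (uX : unit_mass_moment u).

Let mu2 : measurable_fun setT (fun x => u x ^+ 2).
Proof. by case: uX => mu_ _ _; exact: measurable_funX. Qed.

Let i0 : mu.-integrable setT (fun x => (u x ^+ 2)%:E).
Proof. by case: uX => mu_ u1 _; apply: sqr_integrable => //; rewrite u1 ltry. Qed.

Let i1 : mu.-integrable setT (fun x => (`|x| * u x ^+ 2)%:E).
Proof.
case: uX => _ _ um; apply/integrableP; split.
  by apply/measurable_EFinP; apply: measurable_funM => //; exact: measurableT_comp.
apply: le_lt_trans um; rewrite le_eqVlt; apply/orP; left; apply/eqP.
by apply: eq_integral => x _; rewrite gee0_abs// lee_fin mulr_ge0 ?sqr_ge0.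
Qed.

Let I0 : \int[mu]_x (u x ^+ 2) = 1.
Proof. by case: uX => _ u1 _; rewrite /Rintegral u1. Qed.

Lemma momentE : (\int[mu]_x (`|x| * u x ^+ 2)%:E = (moment u)%:E)%E.
Proof. by rewrite fineK//; exact: integrable_fin_num. Qed.

Let a x : R := \int[mu]_y (`|x - y| * u y ^+ 2).

Let ia x : mu.-integrable setT (fun y => (`|x - y| * u y ^+ 2)%:E).
Proof.
apply: (@le_integrable _ _ _ mu setT measurableT _
  (fun y => ((`|x| * u y ^+ 2)%:E + (`|y| * u y ^+ 2)%:E)%E)).
- apply/measurable_EFinP; apply: measurable_funM => //.
  by apply: measurableT_comp => //; exact: measurable_funB.
- move=> y _; rewrite -EFinD lee_fin -mulrDl.
  have u0 := sqr_ge0 (u y).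
  have xy0 : 0 <= `|x| + `|y| by rewrite addr_ge0.
  by rewrite (ger0_norm (mulr_ge0 _ u0))// (ger0_norm (mulr_ge0 xy0 u0)) ler_wpM2r//; exact: ler_normB.
- by apply: integrableD => //; have := integrableZl measurableT `|x| i0.
Qed.

Lemma coulombE : coulomb u = \int[mu]_x (u x ^+ 2 * a x).
Proof.
apply: eq_Rintegral => x _; rewrite -RintegralZl//; last exact: ia.
by apply: eq_Rintegral => y _; ring.
Qed.

Let a_ge0 x : 0 <= a x.
Proof. by apply: Rintegral_ge0 => y _; rewrite mulr_ge0 ?sqr_ge0. Qed.

Let a_le x : a x <= `|x| + moment u.
Proof.
rewrite -[`|x|]mulr1 -I0 -RintegralZl// -RintegralD//; last first.
  by have := integrableZl measurableT `|x| i0.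
apply: le_Rintegral => //; first exact: ia.
  exact: (integrableD measurableT (integrableZl measurableT `|x| i0) i1).
by move=> y _; rewrite -mulrDl ler_wpM2r ?sqr_ge0//; exact: ler_normB.
Qed.

Let ma : measurable_fun setT (fun x => u x ^+ 2 * a x).
Proof.
apply: measurable_funM => //.
have mf : measurable_fun setT (fun p : R * R => (`|p.1 - p.2| * u p.2 ^+ 2)%:E).
  apply/measurable_EFinP; apply: measurable_funM; last exact: measurableT_comp mu2 measurable_snd.
  apply: measurableT_comp => //.
  exact: (measurable_funB (measurable_fst) (measurable_snd)).
have f0 (p : R * R) : (0 <= (`|p.1 - p.2| * u p.2 ^+ 2)%:E)%E.
  by rewrite lee_fin mulr_ge0 ?sqr_ge0.
have := @measurable_fun_fubini_tonelli_F _ _ _ _ R mu _ mf f0.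
rewrite /fubini_F/= => mF.
apply/measurable_EFinP; rewrite [X in measurable_fun _ X](_ : _ = fun x => \int[mu]_y (`|x - y| * u y ^+ 2)%:E)%E//.
by apply/funext => x; rewrite /= fineK//; exact: integrable_fin_num (ia x).
Qed.

Let i2 : mu.-integrable setT (fun x => (u x ^+ 2 * a x)%:E).
Proof.
apply: (@le_integrable _ _ _ mu setT measurableT _
  (fun x => ((`|x| * u x ^+ 2)%:E + (moment u * u x ^+ 2)%:E)%E)).
- exact/measurable_EFinP.
- move=> x _; rewrite -EFinD lee_fin -mulrDl.
  have u0 := sqr_ge0 (u x); have h := le_trans (a_ge0 x) (a_le x).
  rewrite (ger0_norm (mulr_ge0 u0 (a_ge0 x))) (ger0_norm (mulr_ge0 h u0)).
  by rewrite mulrC ler_wpM2r.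
- by apply: integrableD => //; have := integrableZl measurableT (moment u) i0.
Qed.

Lemma coulomb_le : coulomb u <= 2 * moment u.
Proof.
rewrite coulombE (_ : 2 * moment u = \int[mu]_x (`|x| * u x ^+ 2 + moment u * u x ^+ 2)).
  apply: le_Rintegral => //.
    exact: (integrableD measurableT i1 (integrableZl measurableT (moment u) i0)).
  by move=> x _; rewrite -mulrDl mulrC ler_wpM2r ?sqr_ge0// a_le.
rewrite RintegralD//; last by have := integrableZl measurableT (moment u) i0.
by rewrite RintegralZl// I0 mulr1 -/(moment u) mulr2n mulrDl mul1r.
Qed.

(** Since u has mass 1, integrating [|x|] and [|y|] against the product density
gives the first moment in both cases. *)
Lemma interactionE z : 1 <= z ->
  (\int[mu]_x \int[mu]_y (pair_kernel z x y * u x ^+ 2 * u y ^+ 2)%:E =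
   (z * moment u - 2^-1 * coulomb u)%:E)%E.
Proof.
move=> z1.
pose F x := u x ^+ 2 * (z * (2^-1 * (`|x| + moment u)) - 2^-1 * a x).
have inner x : (\int[mu]_y (pair_kernel z x y * u x ^+ 2 * u y ^+ 2)%:E = (F x)%:E)%E.
  have j0 := integrableZl measurableT (u x ^+ 2 * (z * 2^-1 * `|x|)) i0.
  have j1 := integrableZl measurableT (u x ^+ 2 * (z * 2^-1)) i1.
  have j2 := integrableZl measurableT (u x ^+ 2 * 2^-1) (ia x).
  have j := integrableB measurableT (integrableD measurableT j0 j1) j2.
  rewrite (_ : F x = \int[mu]_y ((u x ^+ 2 * (z * 2^-1 * `|x|)) * u y ^+ 2 +
     (u x ^+ 2 * (z * 2^-1)) * (`|y| * u y ^+ 2) - (u x ^+ 2 * 2^-1) * (`|x - y| * u y ^+ 2))).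
    rewrite /Rintegral fineK; last exact: integrable_fin_num j.
    by apply: eq_integral => y _; congr EFin; rewrite /pair_kernel; ring.
  rewrite RintegralB//; last exact: (integrableD measurableT j0 j1).
  rewrite RintegralD// !RintegralZl//; last exact: ia.
  by rewrite I0 -/(moment u) -/(a x) /F; ring.
under eq_integral do rewrite inner.
have j0 := integrableZl measurableT (z * 2^-1) i1.
have j1 := integrableZl measurableT (z * 2^-1 * moment u) i0.
have j2 := integrableZl measurableT 2^-1 i2.
have j := integrableB measurableT (integrableD measurableT j0 j1) j2.
rewrite (_ : z * moment u - 2^-1 * coulomb u = \int[mu]_x (z * 2^-1 * (`|x| * u x ^+ 2) +
   z * 2^-1 * moment u * u x ^+ 2 - 2^-1 * (u x ^+ 2 * a x))).
  rewrite /Rintegral fineK; last exact: integrable_fin_num j.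
  by apply: eq_integral => x _; congr EFin; rewrite /F; ring.
rewrite RintegralB//; last exact: (integrableD measurableT j0 j1).
rewrite RintegralD// !RintegralZl//.
by rewrite I0 -/(moment u) coulombE; field.
Qed.

End Identity.

Lemma potential_ge z u : 1 <= z -> unit_mass_moment u ->
  (z - 1) * moment u <= z * moment u - 2^-1 * coulomb u.
Proof. by move=> z1 uX; have := coulomb_le uX; lra. Qed.

(** Fatou's lemma is applied in y, for almost every x, and then in x. *)
Lemma interaction_fatou z (w : nat -> R -> R) u (b : nat -> R) (B : R) : 1 <= z ->
  (forall n, measurable_fun setT (w n)) -> measurable_fun setT u ->
  {ae mu, forall x, w n x @[n --> \oo] --> u x} ->
  (forall n, \int[mu]_x \int[mu]_y (pair_kernel z x y * w n x ^+ 2 * w n y ^+ 2)%:E <= (b n)%:E)%E ->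
  b @ \oo --> B ->
  (\int[mu]_x \int[mu]_y (pair_kernel z x y * u x ^+ 2 * u y ^+ 2)%:E <= B%:E)%E.
Proof.
move=> z1 mw mu_ wu wb bB.
have K0 (v : R -> R) x y : 0 <= pair_kernel z x y * v x ^+ 2 * v y ^+ 2.
  by rewrite mulr_ge0 ?sqr_ge0// mulr_ge0 ?sqr_ge0// pair_kernel_ge0.
have mK (v : R -> R) : measurable_fun setT v ->
    measurable_fun setT (fun p : R * R => pair_kernel z p.1 p.2 * v p.1 ^+ 2 * v p.2 ^+ 2).
  move=> mv; apply: measurable_funM; last first.
    by apply: measurable_funX; exact: measurableT_comp mv measurable_snd.
  apply: measurable_funM; last first.
    by apply: measurable_funX; exact: measurableT_comp mv measurable_fst.
  apply: measurable_funB.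
    apply: measurable_funM => //; apply: measurable_funM => //.
    apply: measurable_funD; apply: measurableT_comp => //.
  apply: measurable_funM => //; apply: measurableT_comp => //.
  exact: (measurable_funB measurable_fst measurable_snd).
have mF (v : R -> R) : measurable_fun setT v ->
    measurable_fun setT (fun x => \int[mu]_y (pair_kernel z x y * v x ^+ 2 * v y ^+ 2)%:E)%E.
  move=> mv; have mK' := (measurable_EFinP _ _).2 (mK _ mv).
  by apply: (@measurable_fun_fubini_tonelli_F _ _ _ _ R mu _ mK') => p; rewrite lee_fin.
(* The inner integrals take extended real values, which is why Fatou's lemma is
   used below for extended real functions in the variable x. *)
pose F n x := (\int[mu]_y (pair_kernel z x y * w n x ^+ 2 * w n y ^+ 2)%:E)%E.
have F0 n x : (0 <= F n x)%E by apply: integral_ge0 => y _; rewrite lee_fin.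
apply: (@le_trans _ _ (\int[mu]_x limn_einf (F ^~ x))%E); last first.
  apply: le_trans (limn_einf_le_cvg wb bB).
  exact: (@fatou _ _ _ mu setT measurableT F (fun n => mF _ (mw n))).
apply: ae_ge0_le_integral => //.
- by move=> x _; apply: integral_ge0 => y _; rewrite lee_fin.
- exact: mF.
- move=> x _; rewrite limn_einf_lim; apply: lime_ge; first exact: is_cvg_einfs.
  by apply: nearW => n; apply: le_ereal_inf_tmp => _ [m _ <-]; exact: F0.
- rewrite (_ : (fun x => _) = -%E \o (fun x => limn_esup (fun n => - F n x)%E))//.
  have mN n : measurable_fun setT (fun x => (- F n x)%E) by exact: measurableT_comp (mF _ (mw n)).
  exact: measurableT_comp (measurable_fun_limn_esup mN).
apply: filterS (wu); first exact: (ae_filter_ringOfSetsType mu).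
move=> x wx _; apply: fatou_ae.
- by move=> n; exact: (measurableT_comp (mK _ (mw n)) (pair1_measurable x)).
- exact: (measurableT_comp (mK _ mu_) (pair1_measurable x)).
- by move=> n y; exact: K0.
apply: filterS wu; first exact: (ae_filter_ringOfSetsType mu).
move=> y wy; apply: cvgM; last exact: cvg_sqr.
by apply: cvgM; [exact: cvg_cst|exact: cvg_sqr].
Qed.

(** * The energy functional on normalised functions *)

(** By uniqueness, the choice made by [wderiv] shares the norm of any weak
derivative that is known to be in L2. *)
Lemma wderiv_spec u h : weak_derivative u h -> h \in Lfun mu 2%:E ->
  [/\ weak_derivative u (wderiv u), wderiv u \in Lfun mu 2%:E &
    normsq (wderiv u) = normsq h].
Proof.
move=> uh hL.
have wd : weak_derivative u (wderiv u) by exact: (@xgetPex _ (cst 0) (weak_derivative u) (ex_intro _ h uh)).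
have [mh hi] := (Lfun2P h).1 hL.
have mw : measurable_fun setT (wderiv u) by case: wd => _ [].
have E : (\int[mu]_x (wderiv u x ^+ 2)%:E = \int[mu]_x (h x ^+ 2)%:E)%E.
  apply: ae_eq_integral => //.
  - by apply/measurable_EFinP; exact: measurable_funX.
  - by apply/measurable_EFinP; exact: measurable_funX.
  - apply: filterS (weak_derivative_unique wd uh); first exact: (ae_filter_ringOfSetsType mu).
    by move=> x /= -> _.
split=> //; last by rewrite /normsq /Rintegral E.
by apply/Lfun2P; split => //; rewrite E.
Qed.

Lemma Lnorm2_eq1 u : ('N[mu]_2%:E[EFin \o u] = 1)%E <-> (\int[mu]_x (u x ^+ 2)%:E = 1)%E.
Proof.
have E : (\int[mu]_x `|(EFin \o u) x| `^ 2 = \int[mu]_x (u x ^+ 2)%:E)%E.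
  by apply: eq_integral => x _ /=; rewrite powR_mulrn// real_normK// num_real.
split=> H.
  rewrite -E -poweR_Lnorm//; rewrite H; exact: poweR1r.
by rewrite unlock E H poweR1r.
Qed.

Lemma calX1P u : calX1 u <-> unit_mass_moment u /\
  exists2 h, weak_derivative u h & h \in Lfun mu 2%:E.
Proof.
split=> [[[[uL wu] um] /Lnorm2_eq1 u1]|[[mu_ u1 um] wu]].
  by split=> //; split=> //; have [] := (Lfun2P u).1 uL.
split; last exact/Lnorm2_eq1.
by split=> //; split=> //; apply/Lfun2P; split=> //; rewrite u1 ltry.
Qed.

Lemma energyE z u : energy z u = normsq (wderiv u) + (z * moment u - 2^-1 * coulomb u).
Proof.
rewrite /energy -/(coulomb u) -/(moment u) (_ : \int[mu]_x _ = normsq (wderiv u)).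
  by ring.
by apply: eq_Rintegral => x _; rewrite real_normK ?num_real.
Qed.

Lemma continuous_locally_integrable u : continuous u -> locally_integrable setT u.
Proof.
move=> cu; split; [exact: continuous_measurable_fun|exact: openT|move=> K _ cK].
have /integrableP[_ +] := continuous_compact_integrable cK (continuous_subspaceT cu).
by [].
Qed.

Lemma test_weak_derivative u : test_function u -> weak_derivative u (u^`())%classic.
Proof.
move=> tu; have su : smooth u by case: tu.
have cu := smooth_continuous su.
have cu' := smooth_continuous (smooth_derive su).
split; [exact: continuous_locally_integrable..|move=> phi tphi].
have sphi : smooth phi by case: tphi.
have cphi := smooth_continuous sphi.
have cphi' := smooth_continuous (smooth_derive sphi).
have [a [b [ab u0 u0']]] := test_support tu.
have out x (p : R -> R) : ~ `[a - 1, b + 1]%classic x ->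
    (forall x, ~ `[a, b]%classic x -> p x = 0) -> p x = 0.
  move=> H; apply; apply: contra_not H => /=; rewrite !in_itv/= => /andP[h1 h2].
  by apply/andP; split; lra.
have : \int[mu]_x (u x * (phi^`())%classic x + (u^`())%classic x * phi x) =
   u (b + 1) * phi (b + 1) - u (a - 1) * phi (a - 1).
  apply: (@Rintegral_derive_supp R (fun x => u x * phi x)).
  - lra.
  - move=> x; apply: is_derive_eq (is_deriveM (smooth_is_derive x su) (smooth_is_derive x sphi)) _.
    by rewrite /GRing.scale/=; ring.
  - by move=> x; apply: cvgD; apply: cvgM; [exact: cu|exact: cphi'|exact: cu'|exact: cphi].
  - by move=> x H; rewrite (out x u H u0) (out x _ H u0') !mul0r addr0.
rewrite (u0 (b + 1)) ?(u0 (a - 1)); last 2 first.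
- by rewrite /= in_itv/= => /andP[h1 h2]; lra.
- by rewrite /= in_itv/= => /andP[h1 h2]; lra.
rewrite !mul0r subr0 RintegralD//.
- by move=> /eqP; rewrite addr_eq0 => /eqP.
- have := locally_integrable_mul (continuous_locally_integrable cphi') cu u0.
  by apply: eq_integrable => // x _; rewrite mulrC.
- have := locally_integrable_mul (continuous_locally_integrable cphi) cu' u0'.
  by apply: eq_integrable => // x _; rewrite mulrC.
Qed.

Lemma continuous_supp_Lfun2 u (a b : R) : continuous u ->
  (forall x, ~ `[a, b]%classic x -> u x = 0) -> u \in Lfun mu 2%:E.
Proof.
move=> cu u0; apply/Lfun2P; split; first exact: continuous_measurable_fun.
have := locally_integrable_mul (continuous_locally_integrable cu) cu u0.
by move=> /(integrable_lty measurableT); under eq_integral do rewrite -expr2.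
Qed.

Lemma test_bump : test_function (@bump R).
Proof.
apply: (@test_functionP _ _ (-1) 1); first exact: smooth_bump.
move=> x /=; rewrite in_itv/= -ler_norml => /negP; rewrite -ltNge => x1.
by rewrite bump_out// ltW.
Qed.

(** A normalised bump; the infimum over an empty set would be infinite. *)
Lemma calX1_nonempty : exists u, @calX1 R u.
Proof.
have sb := @smooth_bump R; have cb := smooth_continuous sb.
have cb' := smooth_continuous (smooth_derive sb).
have [a [b [ab b0 b0']]] := test_support test_bump.
have bL := continuous_supp_Lfun2 cb b0.
have bL' := continuous_supp_Lfun2 cb' b0'.
pose beta : R := normsq (@bump R).
have beta0 : 0 < beta.
  rewrite lt_neqAle normsq_ge0 andbT; apply/eqP => beta0.
  have : (\int[mu]_x `|(bump x ^+ 2)%:E| = 0)%E.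
    rewrite -[RHS]/(0%:E) beta0 -/beta -normsqE//.
    by apply: eq_integral => x _; rewrite gee0_abs// lee_fin sqr_ge0.
  have mb : measurable_fun setT (fun x => (bump x ^+ 2)%:E : \bar R).
    by apply/measurable_EFinP; apply: measurable_funX; exact: continuous_measurable_fun.
  move=> /(ae_eq_integral_abs mu measurableT mb).1 ab0.
  have ab1 : {ae mu, forall x, bump x ^+ 2 = 0}.
    by apply: filterS ab0 => x /(_ I) /= [].
  have [y /eqP] := ae_dense ab1 0 ltr01.
  rewrite sub0r normrN sqrf_eq0 => /eqP by0 y1.
  by have := expR_gt0 (- (bump_gap y)^-1); rewrite -bumpE// by0 ltxx.
pose c := (Num.sqrt beta)^-1.
have c2 : c ^+ 2 * beta = 1.
  by rewrite /c exprVn sqr_sqrtr ?ltW// mulVf// gt_eqF.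
(* The null summand puts u in the form required by [Lfun2_lin] and
   [weak_derivative_lin]. *)
pose u x := c * bump x + 0 * bump x.
have uE x : u x = c * bump x by rewrite /u mul0r addr0.
exists u; apply/calX1P; split.
  split.
  - by have /Lfun2P[] := Lfun2_lin c 0 bL bL.
  - rewrite normsqE; last exact: Lfun2_lin.
    congr EFin; rewrite -c2 /beta /normsq -RintegralZl//.
      by apply: eq_Rintegral => x _; rewrite uE exprMn.
    by have /Lfun2P[] := bL; exact: sqr_integrable.
  - have cc : continuous (fun x : R => `|x| * u x).
      move=> x; apply: cvgM; first exact: norm_continuous.
      by apply: cvgD; apply: cvgM; [exact: cvg_cst|exact: cb|exact: cvg_cst|exact: cb].
    have := locally_integrable_mul (continuous_locally_integrable cc) cb b0.
    move=> /(integrableZl measurableT c)/(integrable_lty measurableT).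
    apply: le_lt_trans; rewrite le_eqVlt; apply/orP; left; apply/eqP.
    by apply: eq_integral => x _; rewrite -EFinM; congr EFin; rewrite uE; ring.
exists (fun x => c * (bump^`())%classic x + 0 * (bump^`())%classic x); last exact: Lfun2_lin.
by apply: weak_derivative_lin; exact/test_weak_derivative/test_bump.
Qed.

End RealLine.

Theorem theorem11 (R : realType) (z : R) (hz : 1 < z) :
  exists2 u : R -> R, calX1 u &
    (energy z u)%:E = ereal_inf [set (energy z v)%:E | v in calX1].
Proof.
set mu := @lebesgue_measure R.
have z1 := ltW hz.
have spec (v : R -> R) : calX1 v -> [/\ unit_mass_moment v, weak_derivative v (wderiv v),
    wderiv v \in Lfun mu 2%:E & (z - 1) * moment v + normsq (wderiv v) <= energy z v].
  move=> /calX1P [vX [h wh hL]]; have [wd wL _] := wderiv_spec wh hL.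
  by split=> //; rewrite energyE addrC lerD2l potential_ge.
have m0 (v : R -> R) : 0 <= moment v.
  by apply: Rintegral_ge0 => x _; rewrite mulr_ge0 ?sqr_ge0.
pose S := [set energy z v | v in calX1].
have S0 : S !=set0 by have [v vX] := @calX1_nonempty R; exists (energy z v), v.
have Slb : has_lbound S.
  exists 0 => _ [v vX <-]; have [_ _ _] := spec v vX; apply: le_trans.
  by rewrite addr_ge0 ?normsq_ge0// mulr_ge0// subr_ge0.
pose e0 := inf S.
suff [u uX ue] : exists2 u, calX1 u & energy z u <= e0.
  exists u => //; apply/eqP; rewrite eq_le; apply/andP; split.
    apply: le_ereal_inf_tmp => _ [v vX <-]; rewrite lee_fin; apply: le_trans ue _.
    by apply: ge_inf => //; exists v.
  by apply: ge_ereal_inf; exists (energy z u)%:E => //; exists u.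
have /choice[v Hv] : forall n : nat, exists v, calX1 v /\ energy z v <= e0 + n.+1%:R^-1.
  move=> n; have [|_ [v vX <-] Hv] := @inf_adherent _ S n.+1%:R^-1 _ (conj S0 Slb).
    by rewrite invr_gt0.
  by exists v; split => //; exact: ltW.
pose g n := wderiv (v n).
have vs n := spec (v n) (Hv n).1.
have vX n : unit_mass_moment (v n) by have [] := vs n.
have wd n : weak_derivative (v n) (g n) by have [] := vs n.
have gL n : g n \in Lfun mu 2%:E by have [] := vs n.
have ebd n : energy z (v n) <= e0 + 1.
  by apply: le_trans (Hv n).2 _; rewrite lerD2l invf_le1// ler1n.
(* Coercivity: as the potential part is at least [(z - 1) * moment (v n)], both
   the kinetic energy and the first moment are bounded along the sequence. *)
have gK n : normsq (g n) <= e0 + 1.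
  have [_ _ _ h] := vs n; apply: le_trans (ebd n); apply: le_trans h.
  by rewrite lerDr mulr_ge0// subr_ge0.
pose C := (e0 + 1) / (z - 1).
have mC n : moment (v n) <= C.
  rewrite ler_pdivlMr ?subr_gt0//; have [_ _ _ h] := vs n.
  by apply: le_trans (ebd n); apply: le_trans h; rewrite mulrC lerDl normsq_ge0.
have v1 n : (\int[mu]_x (v n x ^+ 2)%:E = 1)%E by case: (vX n).
have mv n : measurable_fun setT (v n) by case: (vX n).
have vC n : (\int[mu]_x (`|x| * v n x ^+ 2)%:E <= C%:E)%E.
  by rewrite (momentE (vX n)) lee_fin.
have [f [u [T [M [fk gT mu_ vu vM]]]]] : exists (f : nat -> nat) (u : R -> R) (T M : R),
    [/\ forall k, (k <= f k)%N, normsq (g (f k)) @[k --> \oo] --> T,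
      measurable_fun setT u, {ae mu, forall x, v (f k) x @[k --> \oo] --> u x} &
      {ae mu, forall x, forall n, `|v n x| <= M}].
  by apply: (weak_compactness wd gL gK) => n; rewrite v1.
have vM' : {ae mu, forall x, forall k, `|v (f k) x| <= M}.
  by apply: filterS vM; [exact: (ae_filter_ringOfSetsType mu)|move=> x h k; exact: h].
have u1 := limit_mass (fun k => mv (f k)) mu_ vu vM' (fun k => v1 (f k)) (fun k => vC (f k)).
have um : (\int[mu]_x (`|x| * u x ^+ 2)%:E < +oo)%E.
  apply: (@le_lt_trans _ _ C%:E); last exact: ltry.
  have mabs : measurable_fun setT (fun x : R => `|x|) by exact: measurableT_comp.
  apply: (@fatou_cvg _ _ _ mu (fun k x => `|x| * v (f k) x ^+ 2) _ (fun=> C)).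
  - by move=> k; exact: measurable_funM mabs (measurable_funX 2 (mv (f k))).
  - exact: measurable_funM mabs (measurable_funX 2 mu_).
  - by move=> k x; rewrite mulr_ge0 ?sqr_ge0.
  - apply: filterS vu; first exact: (ae_filter_ringOfSetsType mu).
    by move=> x vx; apply: cvgM; [exact: cvg_cst|exact: cvg_sqr].
  - by move=> k; exact: vC.
  - exact: cvg_cst.
have uX : unit_mass_moment u by split.
have uL : u \in Lfun mu 2%:E by apply/Lfun2P; split=> //; rewrite u1 ltry.
have [h [wh hL hT]] := kinetic_lsc (Lfun2_locally_integrable uL) (fun k => wd (f k))
  (fun k => gL (f k)) (fun k => lexx _) gT
  (fun j => (bounded_cvg_window j (fun k => mv (f k)) mu_ vu vM').1).
exists u; first by apply/calX1P; split=> //; exists h.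
have [_ _ hE] := wderiv_spec wh hL.
(* The kinetic energies tend to T, so what remains of the infimum for the
   potential energy in the limit is [e0 - T]. *)
have : (\int[mu]_x \int[mu]_y (pair_kernel z x y * u x ^+ 2 * u y ^+ 2)%:E <= (e0 - T)%:E)%E.
  apply: (interaction_fatou z1 (fun k => mv (f k)) mu_ vu
     (b := fun k => e0 + k.+1%:R^-1 - normsq (g (f k)))).
    move=> k; rewrite (interactionE (vX _) z1) lee_fin lerBrDr addrC -/(g _).
    rewrite /g -energyE; apply: le_trans (Hv (f k)).2 _; rewrite lerD2l.
    by rewrite lef_pV2 ?posrE// ler_nat ltnS.
  apply: cvgB => //; rewrite -[X in _ --> X]addr0.
  by apply: cvgD; [exact: cvg_cst|exact: cvg_harmonic].
rewrite (interactionE uX z1) lee_fin energyE hE => h2.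
by rewrite -(subrKC T e0); apply: lerD.
Qed.
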